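(* Let $Q=\mathrm{diag}(q_1,\dots,q_n)$, $q_i>0$, and let $P^l\in\mathbb{R}^n$ be constant. Define \[ \overline\theta=\frac{\mathbf{1}_n\mathbf{1}_n^TP^l}{\mathbf{1}_n^TQ^{-1}\mathbf{1}_n},\qquad \overline u=Q^{-1}\overline\theta. \] Suppose there exist $\overline\eta\in\mathcal{R}(D^T)\cap(-\frac{\pi}{2},\frac{\pi}{2})^m$ and $\overline V\in\mathbb{R}^n_{>0}$ with $\overline u-P^l=D\Gamma(\overline V)\boldsymbol{\sin}(\overline\eta)$ and $E(\overline\eta)\overline V=\overline E_{fd}$, and that $(\overline\eta,\overline V)$ satisfies condition $(\ast)$. Let $\mathcal{G}^{comm}$ be a connected undirected graph on $\{1,\dots,n\}$ (the communication graph), with neighbour sets $\mathcal{N}_i^{comm}$. Consider the network dynamics in closed loop with the controllers \[ \dot\theta_i=\sum_{j\in\mathcal{N}_i^{comm}}(\theta_j-\theta_i)-q_i^{-1}\omega_i,\qquad u_i=q_i^{-1}\theta_i,\qquad i=1,\dots,n. \] Then there is a neighbourhood of $(\overline\eta,\mathbf{0},\overline V,\overline\theta)$ such that every closed-loop solution starting in it converges asymptotically to the largest invariant set on which $\omega=\mathbf{0}$, $E(\eta)V-\overline E_{fd}=\mathbf{0}$ (so $V$ equals a constant $\tilde V$), and $\theta=\overline\theta$; on this set $\eta$ is a constant $\tilde\eta$ and $\mathbf{0}=\overline u-D\Gamma(\tilde V)\boldsymbol{\sin}(\tilde\eta)-P^l$, $\mathbf{0}=-E(\tilde\eta)\tilde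 V+\overline E_{fd}$. In particular the frequency deviation converges to zero and $u$ converges to the cost-minimizing generation $\overline u$.
   Context: Standing setup (power network model). $\mathcal{G}=(\mathcal{V},\mathcal{E})$ is a connected undirected graph with node set $\{1,\dots,n\}$ and $m$ edges; each edge $k=\{i,j\}$ is given an arbitrary orientation, and $D\in\mathbb{R}^{n\times m}$ is the incidence matrix: $d_{ik}=+1$ if $i$ is the positive end of edge $k$, $-1$ if $i$ is the negative end, $0$ otherwise. $|D|$ denotes the matrix of entrywise absolute values of $D$. $\mathbf{1}_n$ is the all-ones vector. For each edge $k=\{i,j\}$ there is a susceptance $B_{ij}=B_{ji}>0$; each node has a self-susceptance $B_{ii}<0$ with $|B_{ii}|>\sum_{j\in\mathcal{N}_i}|B_{ij}|$ ($\mathcal{N}_i$ the neighbours of $i$ in $\mathcal{G}$), and reactances $X_{di}>X'_{di}>0$. For $V\in\mathbb{R}^n$, $\Gamma(V)=\mathrm{diag}(\gamma_1,\dots,\gamma_m)$ with $\gamma_k=V_iV_jB_{ij}$ for edge $k=\{i,j\}$. For $\eta\in\mathbb{R}^m$, $E(\eta)\in\mathbb{R}^{n\times n}$ is the symmetric matrix with $E_{ii}=\frac{1-B_{ii}(X_{di}-X'_{di})}{X_{di}-X'_{di}}$, $E_{ij}=-B_{ij}\cos(\eta_k)$ if $k=\{i,j\}$ is an edge, and $E_{ij}=0$ otherwise. $\boldsymbol{\sin}$, $\boldsymbol{\cos}$ act componentwise. $M,A,T$ are diagonal positive definite $n\times n$ matrices ($A=\mathrm{diag}(A_i)$), and $\overline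 E_{fd}\in\mathbb{R}^n$ is a constant vector. The network dynamics, with input $u\in\mathbb{R}^n$ (power generation) and demand $P^l$, are \[ \dot\eta=D^T\omega,\quad M\dot\omega=u-D\Gamma(V)\boldsymbol{\sin}(\eta)-A\omega-P^l,\quad T\dot V=-E(\eta)V+\overline E_{fd},\quad y=\omega, \] with state $(\eta,\omega,V)\in\mathbb{R}^m\times\mathbb{R}^n\times\mathbb{R}^n$. Condition $(\ast)$ on $(\overline\eta,\overline V)$: \[ E(\overline\eta)-\mathrm{diag}(\overline V)^{-1}|D|\Gamma(\overline V)\mathrm{diag}(\boldsymbol{\sin}(\overline\eta))\mathrm{diag}(\boldsymbol{\cos}(\overline\eta))^{-1}\mathrm{diag}(\boldsymbol{\sin}(\overline\eta))|D|^T\mathrm{diag}(\overline V)^{-1}>0. \] *)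

(* Defs.v *)
From Stdlib Require Import Reals Lra Lia List Arith.
From Stdlib Require Import Relation_Operators.
Import ListNotations.
Open Scope R_scope.

(* Nodes are 0..n-1, edges are 0..m-1; vectors are functions nat -> R
   (entries outside the index range are irrelevant). *)

Definition sumR (n : nat) (f : nat -> R) : R :=
  fold_right Rplus 0 (map f (seq 0 n)).

(* Power network data.  Edge k is oriented from [src k] (positive end)
   to [dst k] (negative end). *)
Record Net := mkNet {
  nn  : nat;
  mm  : nat;
  src : nat -> nat;
  dst : nat -> nat;
  Bs  : nat -> nat -> R;     (* susceptances B_ij, self-susceptance B_ii *)
  Xd  : nat -> R;
  Xdp : nat -> R;
  Md  : nat -> R;
  Ad  : nat -> R;
  Td  : nat -> R;
  Efd : nat -> R
}.

Definition joins (N : Net) (k i j : nat) : bool :=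
  ((src N k =? i) && (dst N k =? j)) || ((src N k =? j) && (dst N k =? i))%bool.

Definition padj (N : Net) (i j : nat) : bool :=
  existsb (fun k => joins N k i j) (seq 0 (mm N)).

Definition connected (n : nat) (adj : nat -> nat -> bool) : Prop :=
  forall i j, (i < n)%nat -> (j < n)%nat ->
    clos_refl_trans nat (fun a b => (a < n)%nat /\ (b < n)%nat /\ adj a b = true) i j.

Definition Dinc (N : Net) (i k : nat) : R :=
  if i =? src N k then 1 else if i =? dst N k then -1 else 0.

Definition gam (N : Net) (V : nat -> R) (k : nat) : R :=
  V (src N k) * V (dst N k) * Bs N (src N k) (dst N k).

Definition DGs (N : Net) (V eta : nat -> R) (i : nat) : R :=
  sumR (mm N) (fun k => Dinc N i k * gam N V k * sin (eta k)).

Definition Emat (N : Net) (eta : nat -> R) (i j : nat) : R :=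
  if i =? j then (1 - Bs N i i * (Xd N i - Xdp N i)) / (Xd N i - Xdp N i)
  else sumR (mm N) (fun k => if joins N k i j then - Bs N i j * cos (eta k) else 0).

Definition EV (N : Net) (eta V : nat -> R) (i : nat) : R :=
  sumR (nn N) (fun j => Emat N eta i j * V j).

Definition wf_net (N : Net) : Prop :=
  (forall k, (k < mm N)%nat ->
     (src N k < nn N)%nat /\ (dst N k < nn N)%nat /\ src N k <> dst N k) /\
  (forall k l, (k < mm N)%nat -> (l < mm N)%nat -> k <> l ->
     joins N k (src N l) (dst N l) = false) /\
  connected (nn N) (padj N) /\
  (forall k, (k < mm N)%nat ->
     Bs N (src N k) (dst N k) = Bs N (dst N k) (src N k) /\
     0 < Bs N (src N k) (dst N k)) /\
  (forall i, (i < nn N)%nat ->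
     Bs N i i < 0 /\
     Rabs (Bs N i i) >
       sumR (nn N) (fun j => if padj N i j then Rabs (Bs N i j) else 0)) /\
  (forall i, (i < nn N)%nat -> 0 < Xdp N i /\ Xdp N i < Xd N i) /\
  (forall i, (i < nn N)%nat -> 0 < Md N i /\ 0 < Ad N i /\ 0 < Td N i).

(* Condition (ast) : the symmetric matrix
   E(eb) - diag(Vb)^-1 |D| Gamma(Vb) diag(sin eb) diag(cos eb)^-1 diag(sin eb) |D|^T diag(Vb)^-1
   is positive definite. *)
Definition Smat (N : Net) (eb Vb : nat -> R) (i j : nat) : R :=
  Emat N eb i j
  - / Vb i * sumR (mm N) (fun k => Rabs (Dinc N i k) * gam N Vb k * sin (eb k)
                                   * / cos (eb k) * sin (eb k) * Rabs (Dinc N j k))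
    * / Vb j.

Definition posdef (n : nat) (S : nat -> nat -> R) : Prop :=
  forall x : nat -> R, (exists i, (i < n)%nat /\ x i <> 0) ->
    sumR n (fun i => sumR n (fun j => x i * S i j * x j)) > 0.

Definition cond_star (N : Net) (eb Vb : nat -> R) : Prop :=
  posdef (nn N) (Smat N eb Vb).

Record st := mkst { s_eta : nat -> R; s_om : nat -> R; s_V : nat -> R; s_th : nat -> R }.

Definition uctl (q : nat -> R) (s : st) (i : nat) : R := / q i * s_th s i.

Definition rhs (N : Net) (q Pl : nat -> R) (c : nat -> nat -> bool) (s : st) : st :=
  mkst
    (fun k => sumR (nn N) (fun i => Dinc N i k * s_om s i))
    (fun i => / Md N i * (uctl q s i - DGs N (s_V s) (s_eta s) i
                          - Ad N i * s_om s i - Pl i))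
    (fun i => / Td N i * (- EV N (s_eta s) (s_V s) i + Efd N i))
    (fun i => sumR (nn N) (fun j => if c i j then s_th s j - s_th s i else 0)
              - / q i * s_om s i).

Definition solves_at (N : Net) (q Pl : nat -> R) (c : nat -> nat -> bool)
    (x : R -> st) (t : R) : Prop :=
  let f := rhs N q Pl c (x t) in
  (forall k, (k < mm N)%nat -> derivable_pt_lim (fun s => s_eta (x s) k) t (s_eta f k)) /\
  (forall i, (i < nn N)%nat ->
     derivable_pt_lim (fun s => s_om (x s) i) t (s_om f i) /\
     derivable_pt_lim (fun s => s_V (x s) i) t (s_V f i) /\
     derivable_pt_lim (fun s => s_th (x s) i) t (s_th f i)).

Definition sdist (N : Net) (a b : st) : R :=
  sumR (mm N) (fun k => Rabs (s_eta a k - s_eta b k)) +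
  sumR (nn N) (fun i => Rabs (s_om a i - s_om b i) + Rabs (s_V a i - s_V b i)
                        + Rabs (s_th a i - s_th b i)).

Definition fwd_sol (N : Net) (q Pl : nat -> R) (c : nat -> nat -> bool)
    (x : R -> st) : Prop :=
  (forall t, 0 < t -> solves_at N q Pl c x t) /\
  (forall eps, 0 < eps -> exists del, 0 < del /\
     forall t, 0 <= t < del -> sdist N (x t) (x 0) < eps).

Definition full_sol (N : Net) (q Pl : nat -> R) (c : nat -> nat -> bool)
    (x : R -> st) : Prop :=
  forall t, solves_at N q Pl c x t.

Definition invariant (N : Net) (q Pl : nat -> R) (c : nat -> nat -> bool)
    (W : st -> Prop) : Prop :=
  forall x0, W x0 -> exists x, full_sol N q Pl c x /\ x 0 = x0 /\ forall t, W (x t).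

Definition largest_invariant (N : Net) (q Pl : nat -> R) (c : nat -> nat -> bool)
    (Om : st -> Prop) : st -> Prop :=
  fun s => exists W, invariant N q Pl c W /\ (forall y, W y -> Om y) /\ W s.

Definition converges_to_set (N : Net) (x : R -> st) (S : st -> Prop) : Prop :=
  forall eps, 0 < eps -> exists T, forall t, T <= t -> exists y, S y /\ sdist N (x t) y < eps.

Definition converges_to (f : R -> R) (l : R) : Prop :=
  forall eps, 0 < eps -> exists T, forall t, T <= t -> Rabs (f t - l) < eps.

(* thetabar = 1 1^T P^l / (1^T Q^{-1} 1)  (all entries equal) *)
Definition thetabar (n : nat) (q Pl : nat -> R) (i : nat) : R :=
  sumR n Pl / sumR n (fun j => / q j).

Definition ubar (n : nat) (q Pl : nat -> R) (i : nat) : R :=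
  / q i * thetabar n q Pl i.

Definition Omega (N : Net) (q Pl : nat -> R) (s : st) : Prop :=
  forall i, (i < nn N)%nat ->
    s_om s i = 0 /\ EV N (s_eta s) (s_V s) i - Efd N i = 0 /\
    s_th s i = thetabar (nn N) q Pl i.

(* Main.v *)
From Stdlib Require Import Reals Lra Lia List ZArith Ranalysis5
  Classical IndefiniteDescription FunctionalExtensionality.
Require Import Defs.
Open Scope R_scope.

(* The proof is LaSalle's argument for the incremental energy
     H = 1/2 omega^T M omega + 1/2 |theta - thetabar|^2 + U(eta, V),
   where U is the Bregman divergence at (etab, Vb) of the potential 1/2 V^T E(eta) V.
   Along solutions
   dH/dt = - omega^T A omega - |T^-1/2 (E(eta) V - Efd)|^2 - 1/2 sum_(c i j) (theta_j - theta_i)^2,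
   the cross terms cancelling because ubar - Pl = D Gamma(Vb) sin(etab), E(etab) Vb = Efd and the
   communication Laplacian is symmetric.  Completing the square in eta shows that the Hessian of U
   at (etab, Vb) is positive definite exactly under condition (ast), so H dominates the squared
   distance to the equilibrium on a small ball, and solutions starting close enough stay in a
   compact neighbourhood.  Every late cluster value y of such a solution then has dH/dt = 0, hence
   omega = 0, E V = Efd and theta in consensus; since omega tends to 0 the omega-equation must vanish
   at y, and summing it over the nodes (the line flows cancel) pins the consensus value to
   thetabar.  So y is an equilibrium in Omega, and {y} is invariant. *)

Lemma sumR_0 f : sumR 0 f = 0.
Proof. reflexivity. Qed.

Lemma sumR_S n f : sumR (S n) f = sumR n f + f n.
Proof.
  unfold sumR. rewrite seq_S, map_app, fold_right_app. simpl.
  generalize (f n). induction (map f (seq 0 n)) as [|a l IH]; intro r; simpl.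
  - lra.
  - rewrite IH. lra.
Qed.

Lemma sumR_ext n f g : (forall i, (i < n)%nat -> f i = g i) -> sumR n f = sumR n g.
Proof.
  induction n as [|n IH]; intro H; [reflexivity|].
  rewrite !sumR_S, IH, H; auto.
Qed.

Lemma sumR_plus n f g : sumR n (fun i => f i + g i) = sumR n f + sumR n g.
Proof. induction n as [|n IH]; [unfold sumR; simpl; lra|]. rewrite !sumR_S, IH. lra. Qed.

Lemma sumR_minus n f g : sumR n (fun i => f i - g i) = sumR n f - sumR n g.
Proof. induction n as [|n IH]; [unfold sumR; simpl; lra|]. rewrite !sumR_S, IH. lra. Qed.

Lemma sumR_scal n c f : sumR n (fun i => c * f i) = c * sumR n f.
Proof. induction n as [|n IH]; [unfold sumR; simpl; lra|]. rewrite !sumR_S, IH. lra. Qed.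

Lemma sumR_opp n f : sumR n (fun i => - f i) = - sumR n f.
Proof. induction n as [|n IH]; [unfold sumR; simpl; lra|]. rewrite !sumR_S, IH. lra. Qed.

Lemma sumR_const0 n : sumR n (fun _ => 0) = 0.
Proof. induction n as [|n IH]; [reflexivity|]. rewrite sumR_S, IH. lra. Qed.

Lemma sumR_eq0 n f : (forall i, (i < n)%nat -> f i = 0) -> sumR n f = 0.
Proof. intro H. rewrite (sumR_ext n f (fun _ => 0)) by auto. apply sumR_const0. Qed.

Lemma sumR_swap n m (f : nat -> nat -> R) :
  sumR n (fun i => sumR m (fun k => f i k)) = sumR m (fun k => sumR n (fun i => f i k)).
Proof.
  induction n as [|n IH].
  - rewrite sumR_0. symmetry. apply sumR_eq0. intros. apply sumR_0.
  - rewrite sumR_S, IH, <- sumR_plus. apply sumR_ext. intros. rewrite sumR_S. lra.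
Qed.

Lemma sumR_delta n a (f : nat -> R) : (a < n)%nat ->
  sumR n (fun j => if j =? a then f j else 0) = f a.
Proof.
  induction n as [|n IH]; intro H; [lia|].
  rewrite sumR_S. destruct (Nat.eq_dec a n) as [->|Ha].
  - rewrite Nat.eqb_refl, sumR_eq0; [lra|].
    intros i Hi. destruct (Nat.eqb_spec i n); [lia|auto].
  - rewrite IH by lia. destruct (Nat.eqb_spec n a); [lia|lra].
Qed.

Lemma sumR_delta' n a (f : nat -> R) : (a < n)%nat ->
  sumR n (fun j => if a =? j then f j else 0) = f a.
Proof.
  intro H. rewrite <- (sumR_delta n a f H). apply sumR_ext. intros.
  rewrite Nat.eqb_sym. auto.
Qed.

Lemma sumR_le n f g : (forall i, (i < n)%nat -> f i <= g i) -> sumR n f <= sumR n g.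
Proof.
  induction n as [|n IH]; intro H; [unfold sumR; simpl; lra|].
  rewrite !sumR_S. assert (f n <= g n) by (apply H; lia).
  assert (sumR n f <= sumR n g) by (apply IH; intros; apply H; lia). lra.
Qed.

Lemma sumR_ge0 n f : (forall i, (i < n)%nat -> 0 <= f i) -> 0 <= sumR n f.
Proof. intro H. rewrite <- (sumR_const0 n). apply sumR_le; auto. Qed.

Lemma sumR_ge_term n f a : (forall i, (i < n)%nat -> 0 <= f i) -> (a < n)%nat ->
  f a <= sumR n f.
Proof.
  induction n as [|n IH]; intros H Ha; [lia|]. rewrite sumR_S.
  assert (0 <= f n) by (apply H; lia).
  destruct (Nat.eq_dec a n) as [->|].
  - assert (0 <= sumR n f) by (apply sumR_ge0; intros; apply H; lia). lra.
  - assert (f a <= sumR n f) by (apply IH; [intros; apply H|]; lia). lra.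
Qed.

Lemma sumR_eq0_term n f i : (forall j, (j < n)%nat -> 0 <= f j) -> sumR n f = 0 ->
  (i < n)%nat -> f i = 0.
Proof. intros H0 H Hi. pose proof (sumR_ge_term n f i H0 Hi). pose proof (H0 i Hi). lra. Qed.

Lemma sumR_le_const n f c : (forall i, (i < n)%nat -> f i <= c) -> sumR n f <= INR n * c.
Proof.
  induction n as [|n IH]; intro H; [unfold sumR; simpl; lra|]. rewrite sumR_S, S_INR.
  assert (f n <= c) by (apply H; lia).
  assert (sumR n f <= INR n * c) by (apply IH; intros; apply H; lia). lra.
Qed.

Lemma sumR_cv n (a : nat -> nat -> R) (l : nat -> R) :
  (forall i, (i < n)%nat -> Un_cv (fun p => a p i) (l i)) ->
  Un_cv (fun p => sumR n (a p)) (sumR n l).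
Proof.
  induction n as [|n IH]; intro H.
  - intros e He. exists 0%nat. intros. unfold Rdist. rewrite !sumR_0, Rminus_0_r, Rabs_R0. lra.
  - assert (Un_cv (fun p => sumR n (a p) + a p n) (sumR n l + l n)).
    { apply CV_plus; [apply IH; intros; apply H; lia | apply H; lia]. }
    intros e He. destruct (H0 e He) as [M HM]. exists M. intros. rewrite !sumR_S. auto.
Qed.

Lemma finite_pos_lower_bound m (f : nat -> R) : (forall k, (k < m)%nat -> 0 < f k) ->
  exists c, 0 < c /\ forall k, (k < m)%nat -> c <= f k.
Proof.
  induction m as [|m IH]; intro H; [exists 1; split; [lra | intros; lia]|].
  destruct IH as [c [Hc Hk]]; [intros; apply H; lia|].
  exists (Rmin c (f m)). split; [apply Rmin_glb_lt; auto; apply H; lia|].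
  intros k Hk'. destruct (Nat.eq_dec k m) as [->|]; [apply Rmin_r|].
  eapply Rle_trans; [apply Rmin_l | apply Hk; lia].
Qed.

Lemma finite_upper_bound m (f : nat -> R) : exists c, 0 <= c /\ forall k, (k < m)%nat -> f k <= c.
Proof.
  induction m as [|m IH]; [exists 0; split; [lra | intros; lia]|].
  destruct IH as [c [Hc Hk]]. exists (Rmax c (f m)).
  split; [eapply Rle_trans; [apply Hc | apply Rmax_l]|].
  intros k Hk'. destruct (Nat.eq_dec k m) as [->|]; [apply Rmax_r|].
  eapply Rle_trans; [apply Hk; lia | apply Rmax_l].
Qed.

Lemma Rabs_le_inv a b : Rabs a <= b -> - b <= a <= b.
Proof. intro H. unfold Rabs in H. destruct (Rcase_abs a); lra. Qed.

Lemma Rabs_le_of_sq a r : 0 <= r -> a ^ 2 <= r ^ 2 -> Rabs a <= r.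
Proof. intros Hr H. apply Rabs_le. destruct (Rle_dec 0 a); split; nra. Qed.

Lemma nat_above T : exists M : nat, T <= INR M.
Proof.
  destruct (archimed T) as [Ha _]. destruct (Z_le_gt_dec 0 (up T)).
  - exists (Z.to_nat (up T)). rewrite INR_IZR_INZ, Z2Nat.id by auto. lra.
  - exists 0%nat. simpl. assert (IZR (up T) <= 0) by (apply IZR_le; lia). lra.
Qed.

Lemma Rabs_sub_triang a b c : Rabs (a - c) <= Rabs (a - b) + Rabs (b - c).
Proof. replace (a - c) with ((a - b) + (b - c)) by ring. apply Rabs_triang. Qed.

Section StateDistance.
Variable N : Net.

Let eta_dist a b := sumR (mm N) (fun k => Rabs (s_eta a k - s_eta b k)).
Let node_dist a b i := Rabs (s_om a i - s_om b i) + Rabs (s_V a i - s_V b i)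
                       + Rabs (s_th a i - s_th b i).

Lemma sdist_parts a b : sdist N a b = eta_dist a b + sumR (nn N) (node_dist a b).
Proof. reflexivity. Qed.

Lemma node_dist_ge0 a b i : 0 <= node_dist a b i.
Proof.
  unfold node_dist. pose proof (Rabs_pos (s_om a i - s_om b i)).
  pose proof (Rabs_pos (s_V a i - s_V b i)). pose proof (Rabs_pos (s_th a i - s_th b i)). lra.
Qed.

Lemma eta_dist_ge0 a b : 0 <= eta_dist a b.
Proof. apply sumR_ge0. intros. apply Rabs_pos. Qed.

Lemma sdist_ge0 a b : 0 <= sdist N a b.
Proof.
  pose proof (eta_dist_ge0 a b).
  pose proof (sumR_ge0 (nn N) (node_dist a b) (fun i _ => node_dist_ge0 a b i)).
  rewrite sdist_parts. lra.
Qed.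

Lemma sdist_refl a : sdist N a a = 0.
Proof.
  unfold sdist. rewrite (sumR_eq0 (mm N)), (sumR_eq0 (nn N)); [lra| |];
    intros; rewrite !Rminus_diag, Rabs_R0; lra.
Qed.

Lemma sdist_triang a b c : sdist N a c <= sdist N a b + sdist N b c.
Proof.
  rewrite !sdist_parts.
  assert (eta_dist a c <= eta_dist a b + eta_dist b c).
  { unfold eta_dist. rewrite <- sumR_plus. apply sumR_le. intros; apply Rabs_sub_triang. }
  assert (sumR (nn N) (node_dist a c)
          <= sumR (nn N) (node_dist a b) + sumR (nn N) (node_dist b c)).
  { rewrite <- sumR_plus. apply sumR_le. intros i _. unfold node_dist.
    pose proof (Rabs_sub_triang (s_om a i) (s_om b i) (s_om c i)).
    pose proof (Rabs_sub_triang (s_V a i) (s_V b i) (s_V c i)).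
    pose proof (Rabs_sub_triang (s_th a i) (s_th b i) (s_th c i)). lra. }
  lra.
Qed.

Lemma sdist_eta a b k : (k < mm N)%nat -> Rabs (s_eta a k - s_eta b k) <= sdist N a b.
Proof.
  intro Hk.
  pose proof (sumR_ge_term (mm N) (fun k => Rabs (s_eta a k - s_eta b k)) k
                (fun _ _ => Rabs_pos _) Hk).
  pose proof (sumR_ge0 (nn N) (node_dist a b) (fun i _ => node_dist_ge0 a b i)).
  rewrite sdist_parts. unfold eta_dist. lra.
Qed.

Lemma sdist_node a b i : (i < nn N)%nat -> node_dist a b i <= sdist N a b.
Proof.
  intro Hi. pose proof (eta_dist_ge0 a b).
  pose proof (sumR_ge_term (nn N) (node_dist a b) i (fun j _ => node_dist_ge0 a b j) Hi).
  rewrite sdist_parts. lra.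
Qed.

Lemma sdist_om a b i : (i < nn N)%nat -> Rabs (s_om a i - s_om b i) <= sdist N a b.
Proof.
  intro Hi. pose proof (sdist_node a b i Hi). unfold node_dist in *.
  pose proof (Rabs_pos (s_V a i - s_V b i)). pose proof (Rabs_pos (s_th a i - s_th b i)). lra.
Qed.

Lemma sdist_V a b i : (i < nn N)%nat -> Rabs (s_V a i - s_V b i) <= sdist N a b.
Proof.
  intro Hi. pose proof (sdist_node a b i Hi). unfold node_dist in *.
  pose proof (Rabs_pos (s_om a i - s_om b i)). pose proof (Rabs_pos (s_th a i - s_th b i)). lra.
Qed.

Lemma sdist_th a b i : (i < nn N)%nat -> Rabs (s_th a i - s_th b i) <= sdist N a b.
Proof.
  intro Hi. pose proof (sdist_node a b i Hi). unfold node_dist in *.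
  pose proof (Rabs_pos (s_om a i - s_om b i)). pose proof (Rabs_pos (s_V a i - s_V b i)). lra.
Qed.

End StateDistance.

Section StateContinuity.
Variable N : Net.

Definition scont (F : st -> R) (y : st) : Prop :=
  forall e, 0 < e -> exists d, 0 < d /\ forall z, sdist N z y < d -> Rabs (F z - F y) < e.

Lemma scont_const c y : scont (fun _ => c) y.
Proof. intros e He. exists 1. split; [lra|]. intros. rewrite Rminus_diag, Rabs_R0. auto. Qed.

Lemma scont_eta k y : (k < mm N)%nat -> scont (fun z => s_eta z k) y.
Proof. intros Hk e He. exists e. split; auto. intros z Hz. pose proof (sdist_eta N z y k Hk). lra. Qed.

Lemma scont_om i y : (i < nn N)%nat -> scont (fun z => s_om z i) y.
Proof. intros Hi e He. exists e. split; auto. intros z Hz. pose proof (sdist_om N z y i Hi). lra. Qed.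

Lemma scont_V i y : (i < nn N)%nat -> scont (fun z => s_V z i) y.
Proof. intros Hi e He. exists e. split; auto. intros z Hz. pose proof (sdist_V N z y i Hi). lra. Qed.

Lemma scont_th i y : (i < nn N)%nat -> scont (fun z => s_th z i) y.
Proof. intros Hi e He. exists e. split; auto. intros z Hz. pose proof (sdist_th N z y i Hi). lra. Qed.

Lemma scont_both F G y : scont F y -> scont G y -> forall e, 0 < e ->
  exists d, 0 < d /\ forall z, sdist N z y < d ->
    Rabs (F z - F y) < e /\ Rabs (G z - G y) < e.
Proof.
  intros HF HG e He.
  destruct (HF e He) as [d1 [Hd1 H1]]. destruct (HG e He) as [d2 [Hd2 H2]].
  exists (Rmin d1 d2). split; [apply Rmin_glb_lt; auto|].
  intros z Hz. pose proof (Rmin_l d1 d2). pose proof (Rmin_r d1 d2).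
  split; [apply H1 | apply H2]; lra.
Qed.

Lemma scont_plus F G y : scont F y -> scont G y -> scont (fun z => F z + G z) y.
Proof.
  intros HF HG e He. destruct (scont_both F G y HF HG (e / 2)) as [d [Hd H]]; [lra|].
  exists d. split; auto. intros z Hz. destruct (H z Hz).
  replace (F z + G z - (F y + G y)) with ((F z - F y) + (G z - G y)) by ring.
  eapply Rle_lt_trans; [apply Rabs_triang | lra].
Qed.

Lemma scont_opp F y : scont F y -> scont (fun z => - F z) y.
Proof.
  intros HF e He. destruct (HF e He) as [d [Hd H]]. exists d. split; auto. intros z Hz.
  replace (- F z - - F y) with (- (F z - F y)) by ring. rewrite Rabs_Ropp. auto.
Qed.

Lemma scont_minus F G y : scont F y -> scont G y -> scont (fun z => F z - G z) y.
Proof. intros. apply scont_plus; auto. apply scont_opp; auto. Qed.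

Lemma scont_mult F G y : scont F y -> scont G y -> scont (fun z => F z * G z) y.
Proof.
  intros HF HG e He.
  set (K := Rabs (F y) + Rabs (G y) + 1).
  assert (HK : 1 <= K) by (unfold K; pose proof (Rabs_pos (F y)); pose proof (Rabs_pos (G y)); lra).
  set (e1 := Rmin 1 (e / K)).
  assert (He1 : 0 < e1) by (apply Rmin_glb_lt; [lra | apply Rdiv_lt_0_compat; lra]).
  assert (He1K : e1 * K <= e).
  { assert (e1 <= e / K) by apply Rmin_r.
    replace e with (e / K * K) by (field; lra). apply Rmult_le_compat_r; lra. }
  destruct (scont_both F G y HF HG e1 He1) as [d [Hd H]].
  exists d. split; auto. intros z Hz. destruct (H z Hz) as [A B].
  replace (F z * G z - F y * G y)
    with ((F z - F y) * (G z - G y) + (F z - F y) * G y + F y * (G z - G y)) by ring.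
  assert (e1 <= 1) by apply Rmin_l.
  pose proof (Rabs_pos (F z - F y)). pose proof (Rabs_pos (G z - G y)).
  pose proof (Rabs_pos (F y)). pose proof (Rabs_pos (G y)).
  eapply Rle_lt_trans; [eapply Rle_trans; [apply Rabs_triang|]|].
  { apply Rplus_le_compat_r, Rabs_triang. }
  rewrite !Rabs_mult. unfold K in He1K. nra.
Qed.

Lemma scont_comp (g : R -> R) F y :
  scont F y -> continuity_pt g (F y) -> scont (fun z => g (F z)) y.
Proof.
  intros HF Hg e He. destruct (Hg e He) as [al [Hal H]].
  destruct (HF al Hal) as [d [Hd H2]]. exists d. split; auto. intros z Hz.
  destruct (Req_dec (F z) (F y)) as [E|E]; [rewrite E, Rminus_diag, Rabs_R0; auto|].
  apply (H (F z)). split; [split; [constructor | auto] | apply H2; auto].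
Qed.

Lemma scont_sin F y : scont F y -> scont (fun z => sin (F z)) y.
Proof. intro. apply scont_comp; auto. apply continuity_sin. Qed.

Lemma scont_cos F y : scont F y -> scont (fun z => cos (F z)) y.
Proof. intro. apply scont_comp; auto. apply continuity_cos. Qed.

Lemma scont_abs F y : scont F y -> scont (fun z => Rabs (F z)) y.
Proof. intro. apply scont_comp; auto. apply Rcontinuity_abs. Qed.

Lemma scont_sqr F y : scont F y -> scont (fun z => (F z) ^ 2) y.
Proof. intro. simpl. apply scont_mult; auto. apply scont_mult; auto. apply scont_const. Qed.

Lemma scont_sumR n (F : nat -> st -> R) y : (forall i, (i < n)%nat -> scont (F i) y) ->
  scont (fun z => sumR n (fun i => F i z)) y.
Proof.
  induction n as [|n IH]; intro H; [exact (scont_const 0 y)|].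
  assert (C : scont (fun z => sumR n (fun i => F i z) + F n z) y).
  { apply scont_plus; [apply IH; intros; apply H; lia | apply H; lia]. }
  intros e He. destruct (C e He) as [d [Hd Hz]]. exists d; split; auto.
  intros. rewrite !sumR_S. auto.
Qed.

End StateContinuity.

Lemma inv_succ_eventually_lt e : 0 < e -> exists M, forall k, (M <= k)%nat -> / (INR k + 1) < e.
Proof.
  intro He. destruct (nat_above (/ e)) as [M HM]. exists M. intros k Hk.
  apply le_INR in Hk. pose proof (pos_INR M).
  rewrite <- (Rinv_inv e). apply Rinv_lt_contravar.
  - apply Rmult_lt_0_compat; [apply Rinv_0_lt_compat|]; lra.
  - lra.
Qed.

Definition strict_incr (phi : nat -> nat) := forall k, (phi k < phi (S k))%nat.

Lemma strict_incr_ge phi : strict_incr phi -> forall k, (k <= phi k)%nat.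
Proof. intros H k. induction k; [lia|]. specialize (H k). lia. Qed.

Lemma strict_incr_mono phi : strict_incr phi -> forall k l, (k <= l)%nat -> (phi k <= phi l)%nat.
Proof. intros H k l Hkl. induction Hkl; [lia|]. specialize (H m). lia. Qed.

Lemma strict_incr_comp phi psi :
  strict_incr phi -> strict_incr psi -> strict_incr (fun k => phi (psi k)).
Proof.
  intros H1 H2 k. specialize (H2 k).
  assert (phi (S (psi k)) <= phi (psi (S k)))%nat by (apply strict_incr_mono; auto).
  specialize (H1 (psi k)). lia.
Qed.

Lemma cv_subseq u l phi : strict_incr phi -> Un_cv u l -> Un_cv (fun k => u (phi k)) l.
Proof.
  intros Hp H e He. destruct (H e He) as [M HM]. exists M. intros. apply HM.
  pose proof (strict_incr_ge phi Hp n). lia.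
Qed.

(* If [g M k >= M] for all [M], feeding [g] the successor of the previous index gives a
   strictly increasing sequence of indices. *)
Fixpoint diag_subseq (g : nat -> nat -> nat) (k : nat) : nat :=
  match k with 0 => g 0%nat 0%nat | S k' => g (S (diag_subseq g k')) k end.

Lemma bounded_seq_cv_subseq (u : nat -> R) C : (forall p, Rabs (u p) <= C) ->
  exists l phi, strict_incr phi /\ Un_cv (fun k => u (phi k)) l.
Proof.
  intro HC.
  destruct (Bolzano_Weierstrass u (fun c => -C <= c <= C) (compact_P3 (-C) C)) as [l Hl].
  { intro p. specialize (HC p). apply Rabs_le_inv in HC. lra. }
  assert (G : forall M k, {p : nat | (M <= p)%nat /\ Rabs (u p - l) < / (INR k + 1)}).
  { intros M k. apply constructive_indefinite_description.
    assert (Hk : 0 < / (INR k + 1)) by (apply Rinv_0_lt_compat; pose proof (pos_INR k); lra).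
    destruct (Hl (disc l (mkposreal _ Hk)) M) as [p [Hp1 Hp2]].
    - exists (mkposreal _ Hk). intros x Hx. auto.
    - exists p. split; auto. }
  set (g := fun M k => proj1_sig (G M k)).
  assert (Hg : forall M k, (M <= g M k)%nat /\ Rabs (u (g M k) - l) < / (INR k + 1))
    by (intros; apply (proj2_sig (G M k))).
  clearbody g. exists l, (diag_subseq g). split.
  - intro k. simpl. destruct (Hg (S (diag_subseq g k)) (S k)). lia.
  - intros e He. destruct (inv_succ_eventually_lt e He) as [M HM]. exists M. intros k Hk.
    unfold Rdist. eapply Rlt_trans; [|apply (HM k Hk)].
    destruct k; apply Hg.
Qed.

Lemma bounded_vec_seq_cv_subseq (a : nat -> nat -> R) C n :
  (forall p j, (j < n)%nat -> Rabs (a p j) <= C) ->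
  exists phi y, strict_incr phi /\ forall j, (j < n)%nat -> Un_cv (fun k => a (phi k) j) (y j).
Proof.
  revert a. induction n as [|n IH]; intros a H.
  - exists (fun k => k), (fun _ => 0). split; [intro; lia | intros; lia].
  - destruct (IH a) as [phi [y [Hp Hy]]]; [intros; apply H; lia|].
    destruct (bounded_seq_cv_subseq (fun k => a (phi k) n) C) as [l [psi [Hpsi Hl]]];
      [intros; apply H; lia|].
    exists (fun k => phi (psi k)), (fun j => if j =? n then l else y j).
    split; [apply strict_incr_comp; auto|].
    intros j Hj. destruct (Nat.eqb_spec j n) as [->|]; auto.
    apply (cv_subseq (fun k => a (phi k) j)); auto. apply Hy. lia.
Qed.

Definition state_bounded N C (z : st) : Prop :=
  (forall k, (k < mm N)%nat -> Rabs (s_eta z k) <= C) /\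
  (forall i, (i < nn N)%nat ->
     Rabs (s_om z i) <= C /\ Rabs (s_V z i) <= C /\ Rabs (s_th z i) <= C).

Lemma cv_dist_0 u l : Un_cv u l -> Un_cv (fun k => Rabs (u k - l)) 0.
Proof.
  intros Hu e He. destruct (Hu e He) as [M HM]. exists M. intros.
  unfold Rdist in *. rewrite Rminus_0_r, Rabs_Rabsolu. auto.
Qed.

Lemma bounded_states_cluster N C (z : nat -> st) : (forall p, state_bounded N C (z p)) ->
  exists y, forall e, 0 < e -> forall M, exists p, (M <= p)%nat /\ sdist N (z p) y < e.
Proof.
  intro H.
  destruct (bounded_vec_seq_cv_subseq (fun p => s_eta (z p)) C (mm N)) as [p1 [y1 [H1 C1]]];
    [intros; apply H; auto|].
  destruct (bounded_vec_seq_cv_subseq (fun k => s_om (z (p1 k))) C (nn N)) as [p2 [y2 [H2 C2]]];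
    [intros; apply H; auto|].
  destruct (bounded_vec_seq_cv_subseq (fun k => s_V (z (p1 (p2 k)))) C (nn N)) as [p3 [y3 [H3 C3]]];
    [intros; apply H; auto|].
  destruct (bounded_vec_seq_cv_subseq (fun k => s_th (z (p1 (p2 (p3 k))))) C (nn N))
    as [p4 [y4 [H4 C4]]]; [intros; apply H; auto|].
  assert (H34 : strict_incr (fun k => p3 (p4 k))) by (apply strict_incr_comp; auto).
  assert (H234 : strict_incr (fun k => p2 (p3 (p4 k))))
    by (apply (strict_incr_comp p2 (fun k => p3 (p4 k))); auto).
  set (phi := fun k => p1 (p2 (p3 (p4 k)))).
  assert (Hphi : strict_incr phi) by (apply (strict_incr_comp p1 (fun k => p2 (p3 (p4 k)))); auto).
  set (y := mkst y1 y2 y3 y4). exists y.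
  assert (Hcv : Un_cv (fun k => sdist N (z (phi k)) y) (0 + 0)).
  { unfold sdist. simpl. apply CV_plus.
    - rewrite <- (sumR_const0 (mm N)).
      apply (sumR_cv (mm N) (fun k j => Rabs (s_eta (z (phi k)) j - y1 j))). intros j Hj.
      apply cv_dist_0, (cv_subseq (fun k => s_eta (z (p1 k)) j) _ _ H234), C1, Hj.
    - rewrite <- (sumR_const0 (nn N)).
      apply (sumR_cv (nn N) (fun k i => Rabs (s_om (z (phi k)) i - y2 i)
              + Rabs (s_V (z (phi k)) i - y3 i) + Rabs (s_th (z (phi k)) i - y4 i))).
      intros j Hj. replace 0 with (0 + 0 + 0) by ring.
      apply CV_plus; [apply CV_plus|]; apply cv_dist_0.
      + apply (cv_subseq (fun k => s_om (z (p1 (p2 k))) j) _ _ H34), C2, Hj.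
      + apply (cv_subseq (fun k => s_V (z (p1 (p2 (p3 k)))) j) _ _ H4), C3, Hj.
      + apply C4, Hj. }
  intros e He M. destruct (Hcv e He) as [K HK]. exists (phi (max M K)). split.
  - pose proof (strict_incr_ge phi Hphi (max M K)). lia.
  - specialize (HK (max M K) ltac:(lia)). unfold Rdist in HK.
    rewrite Rplus_0_r, Rminus_0_r in HK.
    pose proof (Rle_abs (sdist N (z (phi (max M K))) y)). lra.
Qed.

Lemma dlim_eq f t a b : derivable_pt_lim f t a -> a = b -> derivable_pt_lim f t b.
Proof. intros; subst; auto. Qed.

Lemma dlim_fun_eq f g t a :
  (forall s, f s = g s) -> derivable_pt_lim f t a -> derivable_pt_lim g t a.
Proof. intros E H. replace g with f; auto. apply functional_extensionality; auto. Qed.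

Lemma dlim_const c t : derivable_pt_lim (fun _ => c) t 0.
Proof. apply derivable_pt_lim_const. Qed.

Lemma dlim_plus f g t a b : derivable_pt_lim f t a -> derivable_pt_lim g t b ->
  derivable_pt_lim (fun s => f s + g s) t (a + b).
Proof. intros. apply (derivable_pt_lim_plus f g); auto. Qed.

Lemma dlim_minus f g t a b : derivable_pt_lim f t a -> derivable_pt_lim g t b ->
  derivable_pt_lim (fun s => f s - g s) t (a - b).
Proof. intros. apply (derivable_pt_lim_minus f g); auto. Qed.

Lemma dlim_mult f g t a b : derivable_pt_lim f t a -> derivable_pt_lim g t b ->
  derivable_pt_lim (fun s => f s * g s) t (a * g t + f t * b).
Proof. intros. apply (derivable_pt_lim_mult f g); auto. Qed.

Lemma dlim_scal c f t a : derivable_pt_lim f t a -> derivable_pt_lim (fun s => c * f s) t (c * a).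
Proof. intro H. eapply dlim_eq; [apply dlim_mult; [apply dlim_const | apply H]|]; cbv beta; ring. Qed.

Lemma dlim_opp f t a : derivable_pt_lim f t a -> derivable_pt_lim (fun s => - f s) t (- a).
Proof. intro H. apply (derivable_pt_lim_opp f); auto. Qed.

Lemma dlim_cos f t a : derivable_pt_lim f t a ->
  derivable_pt_lim (fun s => cos (f s)) t (- sin (f t) * a).
Proof. intro H. apply (derivable_pt_lim_comp f cos); auto. apply derivable_pt_lim_cos. Qed.

Lemma dlim_sq f t a : derivable_pt_lim f t a ->
  derivable_pt_lim (fun s => (f s) ^ 2) t (2 * f t * a).
Proof.
  intro H. eapply dlim_fun_eq; [|eapply dlim_eq; [apply (dlim_mult f f); eauto|]].
  - intros; simpl; ring.
  - ring.
Qed.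

Lemma dlim_sumR n (F : nat -> R -> R) (F' : nat -> R) t :
  (forall i, (i < n)%nat -> derivable_pt_lim (F i) t (F' i)) ->
  derivable_pt_lim (fun s => sumR n (fun i => F i s)) t (sumR n F').
Proof.
  induction n as [|n IH]; intro H; [exact (dlim_const 0 t)|].
  eapply dlim_fun_eq; [intro s; symmetry; apply sumR_S|]. rewrite sumR_S.
  apply dlim_plus; [apply IH; intros; apply H; lia | apply H; lia].
Qed.

Definition wf_edges (N : Net) := forall k, (k < mm N)%nat ->
  (src N k < nn N)%nat /\ (dst N k < nn N)%nat /\ src N k <> dst N k.

Definition edge_B (N : Net) k := Bs N (src N k) (dst N k).

Definition sym_edges (N : Net) := forall k, (k < mm N)%nat ->
  edge_B N k = Bs N (dst N k) (src N k).

Definition Ediag (N : Net) i := (1 - Bs N i i * (Xd N i - Xdp N i)) / (Xd N i - Xdp N i).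

(* Bregman divergence, at (eb, Vb), of the edge potential -B V_src V_dst cos(eta). *)
Definition edge_energy (N : Net) (eb Vb eta V : nat -> R) k :=
  edge_B N k * ( - V (src N k) * V (dst N k) * cos (eta k)
   + Vb (src N k) * Vb (dst N k) * cos (eb k)
   - Vb (src N k) * Vb (dst N k) * sin (eb k) * (eta k - eb k)
   + cos (eb k) * (Vb (dst N k) * (V (src N k) - Vb (src N k))
                   + Vb (src N k) * (V (dst N k) - Vb (dst N k)))).

Definition pot_energy (N : Net) (eb Vb eta V : nat -> R) :=
  sumR (nn N) (fun i => /2 * Ediag N i * (V i - Vb i) ^ 2)
  + sumR (mm N) (edge_energy N eb Vb eta V).

Definition energy (N : Net) (eb Vb : nat -> R) (thb : R) (z : st) :=
  sumR (nn N) (fun i => /2 * Md N i * (s_om z i) ^ 2)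
  + sumR (nn N) (fun i => /2 * (s_th z i - thb) ^ 2)
  + pot_energy N eb Vb (s_eta z) (s_V z).

Definition dissipation (N : Net) (c : nat -> nat -> bool) (z : st) :=
  sumR (nn N) (fun i => Ad N i * (s_om z i) ^ 2)
  + sumR (nn N) (fun i => / Td N i * (EV N (s_eta z) (s_V z) i - Efd N i) ^ 2)
  + /2 * sumR (nn N) (fun i => sumR (nn N) (fun j =>
                        if c i j then (s_th z j - s_th z i) ^ 2 else 0)).

(* Derivative of [energy] at [z] in the direction [f]. *)
Definition energy_rate (N : Net) (eb Vb : nat -> R) (thb : R) (z f : st) :=
  sumR (nn N) (fun i => Md N i * s_om z i * s_om f i)
  + sumR (nn N) (fun i => (s_th z i - thb) * s_th f i)
  + (sumR (nn N) (fun i => Ediag N i * (s_V z i - Vb i) * s_V f i)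
     + sumR (mm N) (fun k => edge_B N k * (
        - (s_V f (src N k) * s_V z (dst N k) + s_V z (src N k) * s_V f (dst N k)) * cos (s_eta z k)
        + s_V z (src N k) * s_V z (dst N k) * sin (s_eta z k) * s_eta f k
        - Vb (src N k) * Vb (dst N k) * sin (eb k) * s_eta f k
        + cos (eb k) * (Vb (dst N k) * s_V f (src N k) + Vb (src N k) * s_V f (dst N k))))).

Lemma energy_deriv N eb Vb thb (x : R -> st) (f : st) t :
  wf_edges N ->
  (forall k, (k < mm N)%nat -> derivable_pt_lim (fun s => s_eta (x s) k) t (s_eta f k)) ->
  (forall i, (i < nn N)%nat ->
     derivable_pt_lim (fun s => s_om (x s) i) t (s_om f i) /\
     derivable_pt_lim (fun s => s_V (x s) i) t (s_V f i) /\
     derivable_pt_lim (fun s => s_th (x s) i) t (s_th f i)) ->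
  derivable_pt_lim (fun s => energy N eb Vb thb (x s)) t (energy_rate N eb Vb thb (x t) f).
Proof.
  intros Hw He Hn. unfold energy, pot_energy, energy_rate. repeat apply dlim_plus.
  - apply dlim_sumR. intros i Hi. destruct (Hn i Hi) as [H _].
    eapply dlim_eq; [apply dlim_scal, dlim_sq, H | cbv beta; field].
  - apply dlim_sumR. intros i Hi. destruct (Hn i Hi) as [_ [_ H]].
    eapply dlim_eq; [apply dlim_scal, dlim_sq, dlim_minus; [apply H | apply dlim_const]|].
    cbv beta; field.
  - apply dlim_sumR. intros i Hi. destruct (Hn i Hi) as [_ [H _]].
    eapply dlim_eq; [apply dlim_scal, dlim_sq, dlim_minus; [apply H | apply dlim_const]|].
    cbv beta; field.
  - apply dlim_sumR. intros k Hk. destruct (Hw k Hk) as [Hs [Hd _]].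
    destruct (Hn _ Hs) as [_ [Vs _]]. destruct (Hn _ Hd) as [_ [Vd _]]. specialize (He k Hk).
    unfold edge_energy. eapply dlim_eq.
    + apply dlim_scal. apply dlim_plus; [apply dlim_minus; [apply dlim_plus|]|].
      * apply dlim_mult; [apply dlim_mult; [apply dlim_opp, Vs | apply Vd] | apply dlim_cos, He].
      * apply dlim_const.
      * apply dlim_scal, dlim_minus; [apply He | apply dlim_const].
      * apply dlim_scal, dlim_plus; apply dlim_scal, dlim_minus;
          [apply Vs | apply dlim_const | apply Vd | apply dlim_const].
    + cbv beta; ring.
Qed.

Lemma sumR_if_out n (b : nat -> bool) m (g : nat -> nat -> R) :
  sumR n (fun j => if b j then 0 else sumR m (g j))
  = sumR m (fun k => sumR n (fun j => if b j then 0 else g j k)).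
Proof.
  rewrite <- sumR_swap. apply sumR_ext. intros. destruct (b i); auto.
  symmetry; apply sumR_const0.
Qed.

Lemma EV_edges N eta V i : wf_edges N -> sym_edges N -> (i < nn N)%nat ->
  EV N eta V i = Ediag N i * V i + sumR (mm N) (fun k =>
     (if src N k =? i then - edge_B N k * cos (eta k) * V (dst N k) else 0)
   + (if dst N k =? i then - edge_B N k * cos (eta k) * V (src N k) else 0)).
Proof.
  intros Hw Hs Hi. unfold EV.
  transitivity (sumR (nn N) (fun j => (if j =? i then Ediag N i * V j else 0) +
     (if i =? j then 0 else
        sumR (mm N) (fun k => if joins N k i j then - Bs N i j * cos (eta k) * V j else 0)))).
  { apply sumR_ext. intros j Hj. unfold Emat.
    destruct (Nat.eqb_spec i j); destruct (Nat.eqb_spec j i); try lia.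
    - subst. unfold Ediag. ring.
    - rewrite Rplus_0_l, Rmult_comm, <- sumR_scal. apply sumR_ext. intros k _.
      destruct (joins N k i j); ring. }
  rewrite sumR_plus, sumR_delta by auto. f_equal.
  rewrite sumR_if_out. apply sumR_ext. intros k Hk.
  destruct (Hw k Hk) as [Hs1 [Hd1 Hne]]. specialize (Hs k Hk).
  transitivity (sumR (nn N) (fun j =>
     (if j =? dst N k then (if src N k =? i then - edge_B N k * cos (eta k) * V (dst N k) else 0) else 0)
   + (if j =? src N k then (if dst N k =? i then - edge_B N k * cos (eta k) * V (src N k) else 0) else 0))).
  { apply sumR_ext. intros j Hj. unfold joins. unfold edge_B in *.
    destruct (Nat.eqb_spec i j); destruct (Nat.eqb_spec j (dst N k));
    destruct (Nat.eqb_spec (src N k) i); destruct (Nat.eqb_spec j (src N k));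
    destruct (Nat.eqb_spec (dst N k) i); destruct (Nat.eqb_spec (src N k) j);
    destruct (Nat.eqb_spec (dst N k) j);
    simpl; subst; try lia; try ring; try (rewrite Hs; ring). }
  rewrite sumR_plus, !sumR_delta by auto. auto.
Qed.

Lemma EV_sub_edges N eta V eb Vb i : wf_edges N -> sym_edges N -> (i < nn N)%nat ->
  EV N eta V i - EV N eb Vb i = Ediag N i * (V i - Vb i) + sumR (mm N) (fun k =>
     (if src N k =? i
      then edge_B N k * (- V (dst N k) * cos (eta k) + cos (eb k) * Vb (dst N k)) else 0)
   + (if dst N k =? i
      then edge_B N k * (- V (src N k) * cos (eta k) + cos (eb k) * Vb (src N k)) else 0)).
Proof.
  intros Hw Hs Hi. rewrite !EV_edges by auto.
  transitivity (Ediag N i * (V i - Vb i) + sumR (mm N) (fun k =>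
     ((if src N k =? i then - edge_B N k * cos (eta k) * V (dst N k) else 0)
    + (if dst N k =? i then - edge_B N k * cos (eta k) * V (src N k) else 0)) -
     ((if src N k =? i then - edge_B N k * cos (eb k) * Vb (dst N k) else 0)
    + (if dst N k =? i then - edge_B N k * cos (eb k) * Vb (src N k) else 0)))).
  - rewrite sumR_minus. ring.
  - f_equal. apply sumR_ext. intros k _. destruct (src N k =? i), (dst N k =? i); ring.
Qed.

Lemma sum_nodes_to_edges N (a f g : nat -> R) : wf_edges N ->
  sumR (nn N) (fun i => a i * sumR (mm N) (fun k =>
      (if src N k =? i then f k else 0) + (if dst N k =? i then g k else 0)))
  = sumR (mm N) (fun k => a (src N k) * f k + a (dst N k) * g k).
Proof.
  intro Hw. transitivity (sumR (nn N) (fun i => sumR (mm N) (fun k =>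
      a i * ((if src N k =? i then f k else 0) + (if dst N k =? i then g k else 0))))).
  { apply sumR_ext. intros. rewrite sumR_scal. auto. }
  rewrite sumR_swap. apply sumR_ext. intros k Hk. destruct (Hw k Hk) as [H1 [H2 _]].
  transitivity (sumR (nn N) (fun i =>
      (if src N k =? i then a i * f k else 0) + (if dst N k =? i then a i * g k else 0))).
  { apply sumR_ext. intros. destruct (src N k =? i), (dst N k =? i); ring. }
  rewrite sumR_plus, !sumR_delta' by auto. auto.
Qed.

Lemma laplacian_form n (c : nat -> nat -> bool) (th : nat -> R) thb :
  (forall i j, c i j = c j i) ->
  sumR n (fun i => (th i - thb) * sumR n (fun j => if c i j then th j - th i else 0))
  = - / 2 * sumR n (fun i => sumR n (fun j => if c i j then (th j - th i) ^ 2 else 0)).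
Proof.
  intro Hc.
  set (S := sumR n (fun i => (th i - thb) * sumR n (fun j => if c i j then th j - th i else 0))).
  assert (E1 : S = sumR n (fun i => sumR n (fun j =>
                     if c i j then (th i - thb) * (th j - th i) else 0))).
  { unfold S. apply sumR_ext. intros. rewrite <- sumR_scal. apply sumR_ext. intros.
    destruct (c i i0); ring. }
  assert (E2 : S = sumR n (fun i => sumR n (fun j =>
                     if c i j then (th j - thb) * (th i - th j) else 0))).
  { rewrite E1, sumR_swap. apply sumR_ext. intros. apply sumR_ext. intros. rewrite Hc. auto. }
  assert (2 * S = - sumR n (fun i => sumR n (fun j => if c i j then (th j - th i) ^ 2 else 0))).
  { replace (2 * S) with (S + S) by ring. rewrite E1 at 1. rewrite E2.
    rewrite <- sumR_plus, <- sumR_opp. apply sumR_ext. intros.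
    rewrite <- sumR_plus, <- sumR_opp. apply sumR_ext. intros. destruct (c i i0); ring. }
  lra.
Qed.

Lemma energy_rate_rhs N q Pl c eb Vb thb (z : st) :
  wf_edges N -> sym_edges N ->
  (forall i, (i < nn N)%nat -> Md N i <> 0) ->
  (forall i, (i < nn N)%nat -> Td N i <> 0) ->
  (forall i, (i < nn N)%nat -> q i <> 0) ->
  (forall i j, c i j = c j i) ->
  (forall i, (i < nn N)%nat -> / q i * thb - Pl i = DGs N Vb eb i) ->
  (forall i, (i < nn N)%nat -> EV N eb Vb i = Efd N i) ->
  energy_rate N eb Vb thb z (rhs N q Pl c z) = - dissipation N c z.
Proof.
  intros Hw Hs HM HT Hq Hc Hu HE. unfold energy_rate, dissipation.
  set (eta := s_eta z). set (om := s_om z). set (V := s_V z). set (th := s_th z).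
  set (f := rhs N q Pl c z).
  set (F := fun k => edge_B N k * (- V (dst N k) * cos (eta k) + cos (eb k) * Vb (dst N k))).
  set (G := fun k => edge_B N k * (- V (src N k) * cos (eta k) + cos (eb k) * Vb (src N k))).
  set (W := fun k => gam N V k * sin (eta k) - gam N Vb k * sin (eb k)).
  assert (Eedge : sumR (mm N) (fun k => edge_B N k * (
        - (s_V f (src N k) * V (dst N k) + V (src N k) * s_V f (dst N k)) * cos (eta k)
        + V (src N k) * V (dst N k) * sin (eta k) * s_eta f k
        - Vb (src N k) * Vb (dst N k) * sin (eb k) * s_eta f k
        + cos (eb k) * (Vb (dst N k) * s_V f (src N k) + Vb (src N k) * s_V f (dst N k))))
     = sumR (mm N) (fun k => s_V f (src N k) * F k + s_V f (dst N k) * G k)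
       + sumR (mm N) (fun k => s_eta f k * W k)).
  { rewrite <- sumR_plus. apply sumR_ext. intros. unfold F, G, W, gam, edge_B. ring. }
  rewrite Eedge, <- (sum_nodes_to_edges N (s_V f)) by auto. clear Eedge.
  (* eta' = D^T omega, so the angle terms pair omega with the line flows D Gamma(V) sin eta. *)
  assert (Eeta : sumR (mm N) (fun k => s_eta f k * W k)
                 = sumR (nn N) (fun i => om i * (DGs N V eta i - DGs N Vb eb i))).
  { unfold f, rhs. simpl.
    transitivity (sumR (mm N) (fun k => sumR (nn N) (fun i => om i * (Dinc N i k * W k)))).
    { apply sumR_ext. intros. rewrite Rmult_comm, <- sumR_scal. apply sumR_ext. intros.
      unfold om. ring. }
    rewrite <- sumR_swap. apply sumR_ext. intros. rewrite sumR_scal. unfold DGs.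
    rewrite <- sumR_minus. f_equal. apply sumR_ext. intros. unfold W. ring. }
  rewrite Eeta. clear Eeta.
  assert (EVd : forall i, (i < nn N)%nat -> EV N eta V i - Efd N i = Ediag N i * (V i - Vb i) +
      sumR (mm N) (fun k => (if src N k =? i then F k else 0) + (if dst N k =? i then G k else 0)))
    by (intros i Hi; rewrite <- (HE i Hi); apply EV_sub_edges; auto).
  transitivity (sumR (nn N) (fun i => - (Ad N i * om i ^ 2)
      - / Td N i * (EV N eta V i - Efd N i) ^ 2
      + (th i - thb) * sumR (nn N) (fun j => if c i j then th j - th i else 0))).
  2:{ rewrite sumR_plus, sumR_minus, sumR_opp, laplacian_form by auto.
      unfold eta, V, th, om. ring. }
  rewrite <- !sumR_plus. apply sumR_ext. intros i Hi.
  unfold f, rhs, uctl. simpl. fold eta om V th.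
  pose proof (EVd i Hi) as E.
  set (X := sumR (mm N) (fun k =>
              (if src N k =? i then F k else 0) + (if dst N k =? i then G k else 0))) in *.
  replace X with (EV N eta V i - Efd N i - Ediag N i * (V i - Vb i)) by lra.
  rewrite <- (Hu i Hi). specialize (HM i Hi). specialize (HT i Hi). specialize (Hq i Hi).
  field. auto.
Qed.

Lemma sin_taylor_bounds x : 0 <= x <= 1 -> x - x ^ 3 / 6 <= sin x <= x.
Proof.
  intro H. pose proof PI2_1.
  destruct (sin_bound x 0 ltac:(lra) ltac:(lra)) as [H1 H2].
  unfold sin_approx, sin_term in *. simpl in *.
  assert (A1 : x - x ^ 3 / 6 <= sin x) by (eapply Rle_trans; [|apply H1]; right; field).
  assert (A2 : sin x <= x - x ^ 3 / 6 + x ^ 5 / 120) by (eapply Rle_trans; [apply H2|]; right; field).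
  split; [lra|]. assert (0 <= x ^ 3) by (apply pow_le; lra).
  assert (x ^ 5 <= x ^ 3)
    by (replace (x ^ 5) with (x ^ 3 * (x * x)) by ring; assert (x * x <= 1) by nra; nra).
  lra.
Qed.

Lemma cos_taylor_bounds x : -1 <= x <= 1 -> 1 - x ^ 2 / 2 <= cos x <= 1 - x ^ 2 / 2 + x ^ 4 / 24.
Proof.
  intro H. pose proof PI2_1.
  destruct (cos_bound x 0 ltac:(lra) ltac:(lra)) as [H1 H2].
  unfold cos_approx, cos_term in *. simpl in *. split.
  - eapply Rle_trans; [|apply H1]; right; field.
  - eapply Rle_trans; [apply H2|]; right; field.
Qed.

Lemma Rabs_sin_le x : -1 <= x <= 1 -> Rabs (sin x) <= Rabs x.
Proof.
  intro H. destruct (Rle_dec 0 x).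
  - destruct (sin_taylor_bounds x ltac:(lra)). assert (x ^ 3 <= x) by (simpl; nra).
    rewrite !Rabs_right; lra.
  - destruct (sin_taylor_bounds (-x) ltac:(lra)). rewrite sin_neg in *.
    assert ((-x) ^ 3 <= -x) by (simpl; nra). rewrite !Rabs_left1; lra.
Qed.

Lemma sin_sub_id_bound x rho : 0 < rho <= 1 -> Rabs x <= rho -> Rabs (sin x - x) <= rho * x ^ 2.
Proof.
  intros Hr Hx. apply Rabs_le_inv in Hx.
  assert (E : forall y, 0 <= y <= rho -> Rabs (sin y - y) <= rho * y ^ 2).
  { intros y Hy. destruct (sin_taylor_bounds y ltac:(lra)). assert (0 <= y ^ 3) by (apply pow_le; lra).
    rewrite Rabs_left1 by lra. assert (y ^ 3 <= rho * y ^ 2).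
    { replace (y ^ 3) with (y * y ^ 2) by ring.
      apply Rmult_le_compat_r; [apply pow2_ge_0 | lra]. }
    lra. }
  destruct (Rle_dec 0 x); [apply E; lra|].
  replace (sin x - x) with (- (sin (-x) - (-x))) by (rewrite sin_neg; ring).
  rewrite Rabs_Ropp. replace (x ^ 2) with ((-x) ^ 2) by ring. apply E; lra.
Qed.

Lemma cos_taylor2_bound x rho : 0 < rho <= 1 -> Rabs x <= rho ->
  Rabs (1 - cos x - x ^ 2 / 2) <= rho * x ^ 2.
Proof.
  intros Hr Hx. apply Rabs_le_inv in Hx. destruct (cos_taylor_bounds x ltac:(lra)).
  assert (x ^ 4 <= rho * x ^ 2 * 24).
  { replace (x ^ 4) with (x ^ 2 * x ^ 2) by ring.
    assert (x ^ 2 <= rho) by nra. assert (0 <= x ^ 2) by apply pow2_ge_0. nra. }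
  apply Rabs_le. lra.
Qed.

Lemma one_minus_cos_bound x : -1 <= x <= 1 -> 0 <= 1 - cos x <= x ^ 2 / 2.
Proof.
  intro H. destruct (cos_taylor_bounds x H).
  assert (x ^ 4 <= x ^ 2 * 1).
  { replace (x ^ 4) with (x ^ 2 * x ^ 2) by ring.
    assert (x ^ 2 <= 1) by nra. assert (0 <= x ^ 2) by apply pow2_ge_0. nra. }
  lra.
Qed.

Lemma Rabs_triang3 a b c : Rabs (a + b - c) <= Rabs a + Rabs b + Rabs c.
Proof.
  unfold Rminus. eapply Rle_trans; [apply Rabs_triang|]. rewrite Rabs_Ropp.
  pose proof (Rabs_triang a b). lra.
Qed.

Lemma edge_rem_factor_bounds ca sa dl rho :
  Rabs ca <= 1 -> Rabs sa <= 1 -> 0 < rho <= 1 -> Rabs dl <= rho ->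
  Rabs (ca * (1 - cos dl - dl ^ 2 / 2) + sa * (sin dl - dl)) <= 2 * rho * dl ^ 2 /\
  Rabs (ca * (1 - cos dl) + sa * (sin dl - dl)) <= 2 * dl ^ 2 /\
  Rabs (ca * cos dl - sa * sin dl - ca) <= 2 * rho.
Proof.
  intros Hca Hsa Hrho Hd.
  pose proof (sin_sub_id_bound dl rho Hrho Hd) as S1.
  pose proof (cos_taylor2_bound dl rho Hrho Hd) as C1.
  assert (Hd' := Rabs_le_inv _ _ Hd).
  pose proof (one_minus_cos_bound dl ltac:(lra)) as C2.
  pose proof (Rabs_sin_le dl ltac:(lra)) as S2.
  assert (Hd2 : 0 <= dl ^ 2) by apply pow2_ge_0.
  assert (Hcos : Rabs ca * Rabs (1 - cos dl) <= 1 * (dl ^ 2 / 2)).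
  { apply Rmult_le_compat; try apply Rabs_pos; auto. rewrite Rabs_right; lra. }
  assert (Hsin : Rabs sa * Rabs (sin dl - dl) <= 1 * (rho * dl ^ 2))
    by (apply Rmult_le_compat; auto; apply Rabs_pos).
  split; [|split].
  - eapply Rle_trans; [apply Rabs_triang|]. rewrite !Rabs_mult.
    assert (Rabs ca * Rabs (1 - cos dl - dl ^ 2 / 2) <= 1 * (rho * dl ^ 2))
      by (apply Rmult_le_compat; auto; apply Rabs_pos).
    lra.
  - eapply Rle_trans; [apply Rabs_triang|]. rewrite !Rabs_mult.
    assert (rho * dl ^ 2 <= dl ^ 2) by nra. lra.
  - replace (ca * cos dl - sa * sin dl - ca) with (- (ca * (1 - cos dl)) - sa * sin dl) by ring.
    eapply Rle_trans; [apply Rabs_triang|]. rewrite Rabs_Ropp, !Rabs_mult, Rabs_Ropp, Rabs_mult.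
    assert (Rabs sa * Rabs (sin dl) <= 1 * rho)
      by (apply Rmult_le_compat; try apply Rabs_pos; auto; lra).
    assert (dl ^ 2 <= rho * rho).
    { rewrite <- (pow2_abs dl). simpl. rewrite Rmult_1_r.
      apply Rmult_le_compat; try apply Rabs_pos; auto. }
    assert (rho * rho <= rho) by nra. lra.
Qed.

(* Cubic remainder of an edge energy after its second-order Taylor polynomial:
   [p, r] are the equilibrium voltages, [ca, sa] the cosine and sine of the equilibrium
   angle, [dl, vs, vd] the deviations. *)
Lemma edge_remainder_bound p r ca sa dl vs vd rho :
  0 < p -> 0 < r -> Rabs ca <= 1 -> Rabs sa <= 1 -> 0 < rho <= 1 ->
  Rabs dl <= rho -> Rabs vs <= rho -> Rabs vd <= rho ->
  Rabs (p * r * (ca * (1 - cos dl - dl ^ 2 / 2) + sa * (sin dl - dl))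
       + (r * vs + p * vd) * (ca * (1 - cos dl) + sa * (sin dl - dl))
       - vs * vd * (ca * cos dl - sa * sin dl - ca))
  <= rho * ((2 * p * r + 2 * (p + r)) * dl ^ 2 + vs ^ 2 + vd ^ 2).
Proof.
  intros Hp Hr Hca Hsa Hrho Hd Hvs Hvd.
  destruct (edge_rem_factor_bounds ca sa dl rho Hca Hsa Hrho Hd) as [A1 [A2 A3]].
  assert (Hd2 : 0 <= dl ^ 2) by apply pow2_ge_0.
  assert (W : Rabs (r * vs + p * vd) <= (p + r) * rho).
  { eapply Rle_trans; [apply Rabs_triang|].
    rewrite !Rabs_mult, (Rabs_right r), (Rabs_right p) by lra.
    assert (r * Rabs vs <= r * rho) by (apply Rmult_le_compat_l; lra).
    assert (p * Rabs vd <= p * rho) by (apply Rmult_le_compat_l; lra). lra. }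
  eapply Rle_trans; [apply Rabs_triang3|].
  rewrite !Rabs_mult, (Rabs_right p), (Rabs_right r) by lra.
  assert (p * r * Rabs (ca * (1 - cos dl - dl ^ 2 / 2) + sa * (sin dl - dl))
          <= p * r * (2 * rho * dl ^ 2)) by (apply Rmult_le_compat_l; auto; nra).
  assert (Rabs (r * vs + p * vd) * Rabs (ca * (1 - cos dl) + sa * (sin dl - dl))
          <= (p + r) * rho * (2 * dl ^ 2)) by (apply Rmult_le_compat; try apply Rabs_pos; auto).
  assert (Rabs vs * Rabs vd * Rabs (ca * cos dl - sa * sin dl - ca)
          <= Rabs vs * Rabs vd * (2 * rho))
    by (apply Rmult_le_compat_l; auto; apply Rmult_le_pos; apply Rabs_pos).
  assert (2 * (Rabs vs * Rabs vd) <= vs ^ 2 + vd ^ 2).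
  { rewrite <- (pow2_abs vs), <- (pow2_abs vd).
    pose proof (pow2_ge_0 (Rabs vs - Rabs vd)). nra. }
  nra.
Qed.

Definition qform n (S : nat -> nat -> R) (v : nat -> R) :=
  sumR n (fun i => sumR n (fun j => v i * S i j * v j)).

Lemma qform_scal n S v r : qform n S (fun i => r * v i) = r ^ 2 * qform n S v.
Proof.
  unfold qform. rewrite <- sumR_scal. apply sumR_ext. intros.
  rewrite <- sumR_scal. apply sumR_ext. intros. ring.
Qed.

Lemma sum_sq_eq0 n v : sumR n (fun i => v i ^ 2) = 0 -> forall i, (i < n)%nat -> v i = 0.
Proof.
  intros H i Hi.
  assert (v i ^ 2 = 0) by (apply (sumR_eq0_term n (fun i => v i ^ 2)); auto; intros; apply pow2_ge_0).
  nra.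
Qed.

Lemma cv_sq a l : Un_cv a l -> Un_cv (fun p => a p ^ 2) (l ^ 2).
Proof.
  intro H. assert (H2 : Un_cv (fun p => a p * a p) (l * l)) by (apply CV_mult; auto).
  intros e He. destruct (H2 e He) as [M HM]. exists M. intros. simpl. rewrite !Rmult_1_r. auto.
Qed.

Lemma cv_le_0 (a b : nat -> R) l : Un_cv a l -> Un_cv b 0 -> (forall k, a k <= b k) -> l <= 0.
Proof.
  intros Ha Hb Hab. destruct (Rle_dec l 0); auto. exfalso.
  destruct (Ha (l/2)) as [N1 H1]; [lra|]. destruct (Hb (l/2)) as [N2 H2]; [lra|].
  specialize (H1 (max N1 N2) ltac:(lia)). specialize (H2 (max N1 N2) ltac:(lia)).
  specialize (Hab (max N1 N2)). unfold Rdist in *. rewrite Rminus_0_r in H2.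
  apply Rabs_def2 in H1. apply Rabs_def2 in H2. lra.
Qed.

Lemma not_coercive_unit_seq n (S : nat -> nat -> R) :
  ~ (exists lam, 0 < lam /\ forall v, qform n S v >= lam * sumR n (fun i => v i ^ 2)) ->
  exists u : nat -> nat -> R, forall k,
    sumR n (fun i => u k i ^ 2) = 1 /\ qform n S (u k) < / (INR k + 1).
Proof.
  intro H.
  assert (Hv : forall k : nat, exists v, qform n S v < / (INR k + 1) * sumR n (fun i => v i ^ 2)).
  { intro k. apply NNPP. intro Hk. apply H. exists (/ (INR k + 1)). split.
    - apply Rinv_0_lt_compat. pose proof (pos_INR k). lra.
    - intro v. apply Rnot_lt_ge. intro. apply Hk. exists v. auto. }
  set (vs := fun k => proj1_sig (constructive_indefinite_description _ (Hv k))).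
  assert (Hvs : forall k, qform n S (vs k) < / (INR k + 1) * sumR n (fun i => vs k i ^ 2))
    by (intro k; apply (proj2_sig (constructive_indefinite_description _ (Hv k)))).
  clearbody vs.
  set (s := fun k => sumR n (fun i => vs k i ^ 2)).
  assert (Hs : forall k, 0 < s k).
  { intro k. assert (0 <= s k) by (apply sumR_ge0; intros; apply pow2_ge_0).
    destruct (Req_dec (s k) 0) as [E|E]; [|lra]. exfalso. specialize (Hvs k).
    change (sumR n (fun i => vs k i ^ 2)) with (s k) in Hvs. rewrite E in Hvs.
    assert (qform n S (vs k) = 0).
    { unfold qform. apply sumR_eq0. intros i Hi. rewrite (sum_sq_eq0 n (vs k) E i Hi).
      apply sumR_eq0. intros. ring. }
    lra. }
  exists (fun k i => / sqrt (s k) * vs k i). intro k. split.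
  - transitivity (/ s k * s k).
    + unfold s. rewrite <- sumR_scal. apply sumR_ext. intros.
      rewrite Rpow_mult_distr, pow_inv, pow2_sqrt by (left; apply Hs). reflexivity.
    + specialize (Hs k). field. lra.
  - rewrite qform_scal, pow_inv, pow2_sqrt by (left; apply Hs).
    specialize (Hvs k). change (sumR n (fun i => vs k i ^ 2)) with (s k) in Hvs.
    specialize (Hs k). apply (Rmult_lt_reg_l (s k)); auto.
    rewrite <- Rmult_assoc, Rinv_r by lra. lra.
Qed.

(* Compactness of the unit sphere: a positive definite form is bounded below by
   a multiple of the squared norm. *)
Lemma posdef_coercive n (S : nat -> nat -> R) : posdef n S ->
  exists lam, 0 < lam /\ forall v, qform n S v >= lam * sumR n (fun i => v i ^ 2).
Proof.
  intro HP. apply NNPP. intro H.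
  destruct (not_coercive_unit_seq n S H) as [u Hu].
  assert (Hu1 : forall k, sumR n (fun i => u k i ^ 2) = 1) by apply Hu.
  assert (Hu2 : forall k, qform n S (u k) < / (INR k + 1)) by apply Hu.
  assert (Hb : forall k i, (i < n)%nat -> Rabs (u k i) <= 1).
  { intros k i Hi. apply Rabs_le_of_sq; [lra|]. rewrite pow1, <- (Hu1 k).
    apply (sumR_ge_term n (fun i => u k i ^ 2)); auto. intros; apply pow2_ge_0. }
  destruct (bounded_vec_seq_cv_subseq u 1 n Hb) as [phi [y [Hphi Hy]]].
  assert (Hy1 : sumR n (fun i => y i ^ 2) = 1).
  { apply (UL_sequence (fun k => sumR n (fun i => u (phi k) i ^ 2))).
    - apply (sumR_cv n (fun k i => u (phi k) i ^ 2)). intros i Hi.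
      apply cv_sq; auto.
    - intros e He. exists 0%nat. intros. unfold Rdist. rewrite Hu1, Rminus_diag, Rabs_R0. auto. }
  assert (HyQ : qform n S y <= 0).
  { apply (cv_le_0 (fun k => qform n S (u (phi k))) (fun k => / (INR k + 1))).
    - apply (sumR_cv n (fun k i => sumR n (fun j => u (phi k) i * S i j * u (phi k) j))).
      intros i Hi. apply (sumR_cv n (fun k j => u (phi k) i * S i j * u (phi k) j)). intros j Hj.
      apply CV_mult; [apply CV_mult; auto|auto].
      intros e He. exists 0%nat. intros. unfold Rdist. rewrite Rminus_diag, Rabs_R0. auto.
    - intros e He. destruct (inv_succ_eventually_lt e He) as [M HM]. exists M. intros k Hk.
      unfold Rdist. rewrite Rminus_0_r, Rabs_right; [auto|].
      left. apply Rinv_0_lt_compat. pose proof (pos_INR k). lra.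
    - intro k. specialize (Hu2 (phi k)). pose proof (strict_incr_ge phi Hphi k) as Hk.
      apply le_INR in Hk. pose proof (pos_INR k). left. eapply Rlt_le_trans; [apply Hu2|].
      apply Rinv_le_contravar; lra. }
  assert (Hne : exists i, (i < n)%nat /\ y i <> 0).
  { apply NNPP. intro Hn. assert (sumR n (fun i => y i ^ 2) = 0); [|lra].
    apply sumR_eq0. intros i Hi. destruct (Req_dec (y i) 0) as [E|E]; [rewrite E; ring|].
    exfalso; apply Hn; exists i; auto. }
  specialize (HP y Hne). unfold qform in HyQ. lra.
Qed.

Lemma sumR_outer n (a b : nat -> R) c :
  sumR n (fun i => sumR n (fun j => a i * c * b j)) = c * (sumR n a * sumR n b).
Proof.
  transitivity (sumR n (fun i => (c * a i) * sumR n b)).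
  - apply sumR_ext. intros. rewrite <- sumR_scal. apply sumR_ext. intros. ring.
  - transitivity (sumR n (fun i => (c * sumR n b) * a i)).
    + apply sumR_ext. intros. ring.
    + rewrite sumR_scal. ring.
Qed.

Lemma sumR_absD N k (x : nat -> R) : wf_edges N -> (k < mm N)%nat ->
  sumR (nn N) (fun i => Rabs (Dinc N i k) * x i) = x (src N k) + x (dst N k).
Proof.
  intros Hw Hk. destruct (Hw k Hk) as [H1 [H2 H3]].
  transitivity (sumR (nn N) (fun i =>
                  (if i =? src N k then x i else 0) + (if i =? dst N k then x i else 0))).
  - apply sumR_ext. intros i Hi. unfold Dinc.
    destruct (Nat.eqb_spec i (src N k)); destruct (Nat.eqb_spec i (dst N k)); try lia;
      try rewrite Rabs_R1; try rewrite (Rabs_left (-1)) by lra; try rewrite Rabs_R0; ring.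
  - rewrite sumR_plus, !sumR_delta; auto.
Qed.

Section EnergyExpansion.
Variables (N : Net) (eb Vb eta V : nat -> R).
Let p k := Vb (src N k).
Let r k := Vb (dst N k).
Let ca k := cos (eb k).
Let sa k := sin (eb k).
Let dl k := eta k - eb k.
Let v i := V i - Vb i.
Let vs k := v (src N k).
Let vd k := v (dst N k).
Let w k := r k * vs k + p k * vd k.

Definition edge_quad k := p k * r k * ca k * dl k ^ 2 / 2 + w k * sa k * dl k - vs k * vd k * ca k.
Definition edge_rem k :=
  p k * r k * (ca k * (1 - cos (dl k) - dl k ^ 2 / 2) + sa k * (sin (dl k) - dl k))
  + w k * (ca k * (1 - cos (dl k)) + sa k * (sin (dl k) - dl k))
  - vs k * vd k * (ca k * cos (dl k) - sa k * sin (dl k) - ca k).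
Definition edge_weight k := gam N Vb k * sin (eb k) * / cos (eb k) * sin (eb k).
Definition edge_a k := edge_B N k * p k * r k * ca k.
Definition edge_b k := sa k / (p k * r k * ca k).

Lemma edge_energy_split k : edge_energy N eb Vb eta V k = edge_B N k * (edge_quad k + edge_rem k).
Proof.
  unfold edge_energy, edge_quad, edge_rem. replace (eta k) with (eb k + dl k) by (unfold dl; ring).
  rewrite cos_plus. unfold w, vs, vd, v, p, r, ca, sa, dl. field.
Qed.

Lemma qform_Smat : wf_edges N -> sym_edges N ->
  qform (nn N) (Smat N eb Vb) v = sumR (nn N) (fun i => Ediag N i * v i ^ 2)
     + sumR (mm N) (fun k => - 2 * edge_B N k * ca k * vs k * vd k)
     - sumR (mm N) (fun k => edge_weight k * (vs k / p k + vd k / r k) ^ 2).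
Proof.
  intros Hw Hs. unfold qform, Smat.
  transitivity (sumR (nn N) (fun i => v i * EV N eb v i) -
     sumR (nn N) (fun i => sumR (nn N) (fun j => (v i / Vb i)
       * sumR (mm N) (fun k => Rabs (Dinc N i k) * edge_weight k * Rabs (Dinc N j k))
       * (v j / Vb j)))).
  { rewrite <- sumR_minus. apply sumR_ext. intros. unfold EV.
    rewrite <- sumR_scal, <- sumR_minus. apply sumR_ext. intros.
    unfold Rdiv. replace (sumR (mm N) (fun k => Rabs (Dinc N i k) * edge_weight k * Rabs (Dinc N i0 k)))
      with (sumR (mm N) (fun k => Rabs (Dinc N i k) * gam N Vb k * sin (eb k) * / cos (eb k)
                                  * sin (eb k) * Rabs (Dinc N i0 k))).
    - ring.
    - apply sumR_ext. intros. unfold edge_weight. ring. }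
  f_equal.
  - transitivity (sumR (nn N) (fun i => Ediag N i * v i ^ 2)
      + sumR (nn N) (fun i => v i * sumR (mm N) (fun k =>
          (if src N k =? i then - edge_B N k * cos (eb k) * v (dst N k) else 0)
        + (if dst N k =? i then - edge_B N k * cos (eb k) * v (src N k) else 0)))).
    + rewrite <- sumR_plus. apply sumR_ext. intros. rewrite EV_edges by auto. ring.
    + f_equal. rewrite sum_nodes_to_edges by auto. apply sumR_ext. intros. unfold vs, vd, ca. ring.
  - transitivity (sumR (mm N) (fun k => edge_weight k *
        (sumR (nn N) (fun i => Rabs (Dinc N i k) * (v i / Vb i)) *
         sumR (nn N) (fun j => Rabs (Dinc N j k) * (v j / Vb j))))).
    + transitivity (sumR (nn N) (fun i => sumR (nn N) (fun j => sumR (mm N) (fun k =>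
         (Rabs (Dinc N i k) * (v i / Vb i)) * edge_weight k * (Rabs (Dinc N j k) * (v j / Vb j)))))).
      * apply sumR_ext. intros. apply sumR_ext. intros.
        match goal with |- ?a * ?S * ?b = _ => replace (a * S * b) with ((a * b) * S) by ring end.
        rewrite <- sumR_scal. apply sumR_ext. intros. ring.
      * transitivity (sumR (nn N) (fun i => sumR (mm N) (fun k => sumR (nn N) (fun j =>
          (Rabs (Dinc N i k) * (v i / Vb i)) * edge_weight k * (Rabs (Dinc N j k) * (v j / Vb j)))))).
        -- apply sumR_ext. intros. apply sumR_swap.
        -- rewrite (sumR_swap (nn N) (mm N)). apply sumR_ext. intros k Hk. apply sumR_outer.
    + apply sumR_ext. intros k Hk. rewrite !sumR_absD by auto. unfold vs, vd, p, r. ring.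
Qed.

(* Completing the square in [dl] turns the quadratic part of the energy into the
   form of condition (ast) plus nonnegative edge squares. *)
Lemma quad_energy_decomp : wf_edges N -> sym_edges N ->
  (forall i, (i < nn N)%nat -> 0 < Vb i) ->
  (forall k, (k < mm N)%nat -> - (PI / 2) < eb k < PI / 2) ->
  sumR (nn N) (fun i => /2 * Ediag N i * v i ^ 2) + sumR (mm N) (fun k => edge_B N k * edge_quad k)
  = /2 * qform (nn N) (Smat N eb Vb) v
    + sumR (mm N) (fun k => edge_a k / 2 * (dl k + edge_b k * w k) ^ 2).
Proof.
  intros Hw Hs HV He. rewrite qform_Smat by auto.
  rewrite !Rmult_minus_distr_l, !Rmult_plus_distr_l, <- !sumR_scal.
  transitivity (sumR (nn N) (fun i => / 2 * (Ediag N i * v i ^ 2)) +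
     sumR (mm N) (fun k => / 2 * (- 2 * edge_B N k * ca k * vs k * vd k)
       - /2 * (edge_weight k * (vs k / p k + vd k / r k) ^ 2)
       + edge_a k / 2 * (dl k + edge_b k * w k) ^ 2)).
  2:{ rewrite !sumR_plus, !sumR_minus. ring. }
  f_equal; [apply sumR_ext; intros; ring|].
  apply sumR_ext. intros k Hk. destruct (Hw k Hk) as [H1 [H2 _]].
  assert (0 < p k) by (apply HV; auto). assert (0 < r k) by (apply HV; auto).
  assert (0 < ca k) by (apply cos_gt_0; apply He; auto).
  unfold edge_quad, edge_weight, edge_a, edge_b, gam, edge_B, w.
  fold (p k) (r k) (ca k) (sa k). field. lra.
Qed.

End EnergyExpansion.

Definition edge_part N eb Vb eta V k :=
  edge_a N eb Vb k / 2 * ((eta k - eb k) + edge_b N eb Vb k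
    * (Vb (dst N k) * (V (src N k) - Vb (src N k)) + Vb (src N k) * (V (dst N k) - Vb (dst N k)))) ^ 2
  + edge_B N k * edge_rem N eb Vb eta V k.

Lemma pot_energy_decomp N eb Vb eta V : wf_edges N -> sym_edges N ->
  (forall i, (i < nn N)%nat -> 0 < Vb i) ->
  (forall k, (k < mm N)%nat -> - (PI / 2) < eb k < PI / 2) ->
  pot_energy N eb Vb eta V = /2 * qform (nn N) (Smat N eb Vb) (fun i => V i - Vb i)
    + sumR (mm N) (edge_part N eb Vb eta V).
Proof.
  intros Hw Hs HV He. unfold pot_energy.
  rewrite (sumR_ext (mm N) (edge_energy N eb Vb eta V) (fun k =>
             edge_B N k * edge_quad N eb Vb eta V k + edge_B N k * edge_rem N eb Vb eta V k))
    by (intros; rewrite edge_energy_split; ring).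
  rewrite sumR_plus, <- Rplus_assoc, quad_energy_decomp by auto.
  unfold edge_part. rewrite sumR_plus. ring.
Qed.

Lemma sq_shift_lb t x y : 0 <= t <= /2 -> (x + y) ^ 2 >= t * x ^ 2 - 2 * t * y ^ 2.
Proof.
  intro H.
  assert (E : (x + y) ^ 2 - t * x ^ 2 + 2 * t * y ^ 2
              = (1 - t) * (x + y / (1 - t)) ^ 2 + (t * (1 - 2 * t) / (1 - t)) * y ^ 2)
    by (field; lra).
  assert (0 <= (1 - t) * (x + y / (1 - t)) ^ 2) by (apply Rmult_le_pos; [lra | apply pow2_ge_0]).
  assert (0 <= (t * (1 - 2 * t) / (1 - t)) * y ^ 2).
  { apply Rmult_le_pos; [|apply pow2_ge_0]. unfold Rdiv.
    apply Rmult_le_pos; [apply Rmult_le_pos; lra | left; apply Rinv_0_lt_compat; lra]. }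
  lra.
Qed.

Lemma weighted_sum_sq_le p r vs vd : (r * vs + p * vd) ^ 2 <= 2 * (p ^ 2 + r ^ 2) * (vs ^ 2 + vd ^ 2).
Proof.
  assert (0 <= (r * vs - p * vd) ^ 2) by apply pow2_ge_0.
  assert (0 <= p ^ 2 * vs ^ 2) by (apply Rmult_le_pos; apply pow2_ge_0).
  assert (0 <= r ^ 2 * vd ^ 2) by (apply Rmult_le_pos; apply pow2_ge_0). nra.
Qed.

Lemma Rle_div_mul x y d : 0 < d -> x <= y / d -> x * d <= y.
Proof. intros Hd H. replace y with (y / d * d) by (field; lra). apply Rmult_le_compat_r; lra. Qed.

Lemma sum_edges_sq_le N (v : nat -> R) : wf_edges N ->
  sumR (mm N) (fun k => v (src N k) ^ 2 + v (dst N k) ^ 2)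
  <= INR (mm N) * (2 * sumR (nn N) (fun i => v i ^ 2)).
Proof.
  intro Hw. apply sumR_le_const. intros k Hk. destruct (Hw k Hk) as [H1 [H2 _]].
  pose proof (sumR_ge_term _ (fun i => v i ^ 2) _ (fun i _ => pow2_ge_0 (v i)) H1).
  pose proof (sumR_ge_term _ (fun i => v i ^ 2) _ (fun i _ => pow2_ge_0 (v i)) H2). lra.
Qed.

(* One edge of the decomposition of [pot_energy_decomp]: part [t] of the square
   controls [dl], the rest is paid by the node voltages; [rem] is the cubic remainder. *)
Lemma edge_term_lb a a0 b t kap B bet Bm rho p r dl vs vd rem :
  0 < a0 <= a -> 0 < t <= /2 -> 2 * a * b ^ 2 * (p ^ 2 + r ^ 2) <= kap ->
  0 < B -> B * (2 * p * r + 2 * (p + r)) <= bet -> B <= Bm -> 0 <= rho ->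
  Rabs rem <= rho * ((2 * p * r + 2 * (p + r)) * dl ^ 2 + vs ^ 2 + vd ^ 2) ->
  a / 2 * (dl + b * (r * vs + p * vd)) ^ 2 + B * rem
  >= (t * a0 / 2 - rho * bet) * dl ^ 2 - (t * kap + rho * Bm) * (vs ^ 2 + vd ^ 2).
Proof.
  intros Ha Ht Hkap HB Hbet HBm Hrho Hrem.
  assert (Hd2 : 0 <= dl ^ 2) by apply pow2_ge_0.
  assert (Hv2 : 0 <= vs ^ 2 + vd ^ 2) by (pose proof (pow2_ge_0 vs); pose proof (pow2_ge_0 vd); lra).
  assert (Quad : a / 2 * (dl + b * (r * vs + p * vd)) ^ 2
                 >= t * a0 / 2 * dl ^ 2 - t * kap * (vs ^ 2 + vd ^ 2)).
  { pose proof (sq_shift_lb t dl (b * (r * vs + p * vd)) ltac:(lra)) as S.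
    pose proof (weighted_sum_sq_le p r vs vd) as Wq.
    assert (a / 2 * (dl + b * (r * vs + p * vd)) ^ 2
            >= a / 2 * (t * dl ^ 2 - 2 * t * (b * (r * vs + p * vd)) ^ 2))
      by (apply Rle_ge, Rmult_le_compat_l; lra).
    assert (a * b ^ 2 * (r * vs + p * vd) ^ 2 <= a * b ^ 2 * (2 * (p ^ 2 + r ^ 2) * (vs ^ 2 + vd ^ 2)))
      by (apply Rmult_le_compat_l; auto; apply Rmult_le_pos; [lra | apply pow2_ge_0]).
    assert (2 * a * b ^ 2 * (p ^ 2 + r ^ 2) * (vs ^ 2 + vd ^ 2) <= kap * (vs ^ 2 + vd ^ 2))
      by (apply Rmult_le_compat_r; auto).
    assert (t * a0 * dl ^ 2 <= t * a * dl ^ 2) by (apply Rmult_le_compat_r; auto; nra).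
    assert (t * (a * b ^ 2 * (r * vs + p * vd) ^ 2) <= t * (kap * (vs ^ 2 + vd ^ 2)))
      by (apply Rmult_le_compat_l; lra).
    replace ((b * (r * vs + p * vd)) ^ 2) with (b ^ 2 * (r * vs + p * vd) ^ 2) in * by ring. nra. }
  assert (Rem : B * rem >= - (rho * bet * dl ^ 2 + rho * Bm * (vs ^ 2 + vd ^ 2))).
  { apply Rabs_le_inv in Hrem.
    assert (B * rem >= - (B * (rho * ((2 * p * r + 2 * (p + r)) * dl ^ 2 + vs ^ 2 + vd ^ 2)))).
    { apply Rle_ge. rewrite Ropp_mult_distr_r. apply Rmult_le_compat_l; lra. }
    assert (B * (2 * p * r + 2 * (p + r)) * dl ^ 2 <= bet * dl ^ 2) by (apply Rmult_le_compat_r; auto).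
    assert (B * (vs ^ 2 + vd ^ 2) <= Bm * (vs ^ 2 + vd ^ 2)) by (apply Rmult_le_compat_r; auto).
    assert (rho * (B * (2 * p * r + 2 * (p + r)) * dl ^ 2 + B * (vs ^ 2 + vd ^ 2))
            <= rho * (bet * dl ^ 2 + Bm * (vs ^ 2 + vd ^ 2))) by (apply Rmult_le_compat_l; lra).
    replace (B * (rho * ((2 * p * r + 2 * (p + r)) * dl ^ 2 + vs ^ 2 + vd ^ 2)))
      with (rho * (B * (2 * p * r + 2 * (p + r)) * dl ^ 2 + B * (vs ^ 2 + vd ^ 2))) in * by ring.
    lra. }
  lra.
Qed.

Lemma choose_margins lam a0 kap bet Bm M :
  0 < lam -> 0 < a0 -> 0 <= kap -> 0 <= bet -> 0 <= Bm -> 0 <= M ->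
  exists t rho, 0 < t <= /2 /\ 0 < rho <= 1 /\
    8 * M * kap * t <= lam /\ 16 * M * Bm * rho <= lam /\ 4 * bet * rho <= t * a0.
Proof.
  intros Hlam Ha0 Hkap Hbet HBm HM.
  set (t := Rmin (/2) (lam / (8 * M * kap + 1))).
  assert (Ht : 0 < t <= /2)
    by (split; [apply Rmin_glb_lt; [lra | apply Rdiv_lt_0_compat; nra] | apply Rmin_l]).
  set (rho := Rmin 1 (Rmin (lam / (16 * M * Bm + 1)) (t * a0 / (4 * bet + 1)))).
  assert (Hr : 0 < rho <= 1).
  { split; [|apply Rmin_l].
    apply Rmin_glb_lt; [lra | apply Rmin_glb_lt; apply Rdiv_lt_0_compat; nra]. }
  exists t, rho. split; auto. split; [auto | split; [|split]].
  - assert (t * (8 * M * kap + 1) <= lam) by (apply Rle_div_mul; [nra | apply Rmin_r]). nra.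
  - assert (rho <= lam / (16 * M * Bm + 1)) by (eapply Rle_trans; [apply Rmin_r | apply Rmin_l]).
    apply Rle_div_mul in H; nra.
  - assert (rho <= t * a0 / (4 * bet + 1)) by (eapply Rle_trans; [apply Rmin_r | apply Rmin_r]).
    apply Rle_div_mul in H; nra.
Qed.

Lemma pot_energy_lb N eb Vb : wf_edges N -> sym_edges N ->
  (forall i, (i < nn N)%nat -> 0 < Vb i) ->
  (forall k, (k < mm N)%nat -> - (PI / 2) < eb k < PI / 2) ->
  (forall k, (k < mm N)%nat -> 0 < edge_B N k) ->
  posdef (nn N) (Smat N eb Vb) ->
  exists rho mu, 0 < rho <= 1 /\ 0 < mu /\ forall eta V,
    (forall k, (k < mm N)%nat -> Rabs (eta k - eb k) <= rho) ->
    (forall i, (i < nn N)%nat -> Rabs (V i - Vb i) <= rho) ->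
    pot_energy N eb Vb eta V
    >= mu * (sumR (mm N) (fun k => (eta k - eb k) ^ 2) + sumR (nn N) (fun i => (V i - Vb i) ^ 2)).
Proof.
  intros Hw Hs HV He HB HP.
  destruct (posdef_coercive _ _ HP) as [lam [Hlam Hq]].
  destruct (finite_pos_lower_bound (mm N) (edge_a N eb Vb)) as [a0 [Ha0 Hak]].
  { intros k Hk. destruct (Hw k Hk) as [H1 [H2 _]]. unfold edge_a.
    assert (0 < cos (eb k)) by (apply cos_gt_0; apply He; auto).
    repeat apply Rmult_lt_0_compat; auto. }
  destruct (finite_upper_bound (mm N) (fun k => 2 * edge_a N eb Vb k * edge_b N eb Vb k ^ 2
              * (Vb (src N k) ^ 2 + Vb (dst N k) ^ 2))) as [kap [Hkap Hkapk]].
  destruct (finite_upper_bound (mm N) (fun k => edge_B N k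
              * (2 * Vb (src N k) * Vb (dst N k) + 2 * (Vb (src N k) + Vb (dst N k)))))
    as [bet [Hbet Hbetk]].
  destruct (finite_upper_bound (mm N) (edge_B N)) as [Bm [HBm HBmk]].
  set (M := INR (mm N)). assert (HM : 0 <= M) by apply pos_INR.
  destruct (choose_margins lam a0 kap bet Bm M) as [t [rho [Ht [Hr [Ht2 [Hr2 Hr3]]]]]]; auto.
  exists rho, (Rmin (lam / 8) (t * a0 / 4)). split; auto. split; [apply Rmin_glb_lt; nra|].
  intros eta V Hdl Hv.
  set (Sd := sumR (mm N) (fun k => (eta k - eb k) ^ 2)).
  set (Sv := sumR (nn N) (fun i => (V i - Vb i) ^ 2)).
  set (Se := sumR (mm N) (fun k => (V (src N k) - Vb (src N k)) ^ 2
                                   + (V (dst N k) - Vb (dst N k)) ^ 2)).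
  assert (HSe : Se <= M * (2 * Sv)) by (apply (sum_edges_sq_le N (fun i => V i - Vb i)); auto).
  assert (HSd : 0 <= Sd) by (apply sumR_ge0; intros; apply pow2_ge_0).
  assert (HSv : 0 <= Sv) by (apply sumR_ge0; intros; apply pow2_ge_0).
  assert (HSe0 : 0 <= Se).
  { apply sumR_ge0; intros k _.
    pose proof (pow2_ge_0 (V (src N k) - Vb (src N k))).
    pose proof (pow2_ge_0 (V (dst N k) - Vb (dst N k))). lra. }
  rewrite pot_energy_decomp by auto.
  assert (HQ : /2 * qform (nn N) (Smat N eb Vb) (fun i => V i - Vb i) >= lam / 2 * Sv)
    by (specialize (Hq (fun i => V i - Vb i)); cbv beta in Hq; fold Sv in Hq; lra).
  assert (HE : sumR (mm N) (edge_part N eb Vb eta V)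
               >= (t * a0 / 2 - rho * bet) * Sd - (t * kap + rho * Bm) * Se).
  { unfold Sd, Se. rewrite <- !sumR_scal, <- sumR_minus. apply Rle_ge, sumR_le.
    intros k Hk. apply Rge_le. destruct (Hw k Hk) as [H1 [H2 _]]. unfold edge_part.
    apply (edge_term_lb _ a0 _ _ _ _ _ _ _ (Vb (src N k)) (Vb (dst N k))); auto.
    - lra.
    - unfold edge_rem. apply edge_remainder_bound; auto.
      + apply Rabs_le, COS_bound.
      + apply Rabs_le, SIN_bound. }
  assert ((t * kap + rho * Bm) * Se <= (t * kap + rho * Bm) * (M * (2 * Sv))).
  { apply Rmult_le_compat_l; auto. apply Rplus_le_le_0_compat; apply Rmult_le_pos; lra. }
  assert (Rmin (lam / 8) (t * a0 / 4) * (Sd + Sv) <= t * a0 / 4 * Sd + lam / 8 * Sv).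
  { pose proof (Rmin_l (lam / 8) (t * a0 / 4)). pose proof (Rmin_r (lam / 8) (t * a0 / 4)). nra. }
  nra.
Qed.

Section VectorFieldContinuity.
Variables (N : Net) (q Pl : nat -> R) (c : nat -> nat -> bool).
Hypothesis Hw : wf_edges N.

Lemma scont_DGs i y : scont N (fun z => DGs N (s_V z) (s_eta z) i) y.
Proof.
  unfold DGs. apply scont_sumR. intros k Hk. destruct (Hw k Hk) as [H1 [H2 _]].
  unfold gam. apply scont_mult; [apply scont_mult; [apply scont_const|]|].
  - apply scont_mult; [apply scont_mult; apply scont_V; auto | apply scont_const].
  - apply scont_sin, scont_eta; auto.
Qed.

Lemma scont_EV i y : scont N (fun z => EV N (s_eta z) (s_V z) i) y.
Proof.
  unfold EV. apply scont_sumR. intros j Hj. apply scont_mult; [|apply scont_V; auto].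
  unfold Emat. destruct (i =? j); [apply scont_const|].
  apply scont_sumR. intros k Hk. destruct (joins N k i j); [|apply scont_const].
  apply scont_mult; [apply scont_const | apply scont_cos, scont_eta; auto].
Qed.

Lemma scont_rhs_eta k y : scont N (fun z => s_eta (rhs N q Pl c z) k) y.
Proof.
  simpl. apply scont_sumR. intros. apply scont_mult; [apply scont_const | apply scont_om; auto].
Qed.

Lemma scont_rhs_om i y : (i < nn N)%nat -> scont N (fun z => s_om (rhs N q Pl c z) i) y.
Proof.
  intro Hi. unfold rhs, uctl. simpl. apply scont_mult; [apply scont_const|].
  repeat apply scont_minus; try apply scont_const; try apply scont_DGs.
  - apply scont_mult; [apply scont_const | apply scont_th; auto].
  - apply scont_mult; [apply scont_const | apply scont_om; auto].
Qed.

Lemma scont_rhs_V i y : scont N (fun z => s_V (rhs N q Pl c z) i) y.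
Proof.
  simpl. apply scont_mult; [apply scont_const|].
  apply scont_plus; [apply scont_opp, scont_EV | apply scont_const].
Qed.

Lemma scont_rhs_th i y : (i < nn N)%nat -> scont N (fun z => s_th (rhs N q Pl c z) i) y.
Proof.
  intro Hi. simpl. apply scont_minus.
  - apply scont_sumR. intros j Hj. destruct (c i j); [|apply scont_const].
    apply scont_minus; apply scont_th; auto.
  - apply scont_mult; [apply scont_const | apply scont_om; auto].
Qed.

Definition zero_state := mkst (fun _ => 0) (fun _ => 0) (fun _ => 0) (fun _ => 0).

Lemma scont_speed y : scont N (fun z => sdist N (rhs N q Pl c z) zero_state) y.
Proof.
  unfold sdist. apply scont_plus.
  - apply scont_sumR. intros. apply scont_abs, scont_minus; [apply scont_rhs_eta | apply scont_const].
  - apply scont_sumR. intros i Hi.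
    repeat apply scont_plus; apply scont_abs, scont_minus; try apply scont_const.
    + apply scont_rhs_om; auto.
    + apply scont_rhs_V.
    + apply scont_rhs_th; auto.
Qed.

Lemma scont_dissipation y : scont N (dissipation N c) y.
Proof.
  unfold dissipation. repeat apply scont_plus.
  - apply scont_sumR. intros. apply scont_mult; [apply scont_const | apply scont_sqr, scont_om; auto].
  - apply scont_sumR. intros. apply scont_mult; [apply scont_const|].
    apply scont_sqr, scont_minus; [apply scont_EV | apply scont_const].
  - apply scont_mult; [apply scont_const|]. apply scont_sumR. intros i Hi.
    apply scont_sumR. intros j Hj. destruct (c i j); [|apply scont_const].
    apply scont_sqr, scont_minus; apply scont_th; auto.
Qed.

Lemma scont_energy eb Vb thb y : scont N (energy N eb Vb thb) y.
Proof.
  unfold energy, pot_energy. repeat apply scont_plus.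
  - apply scont_sumR. intros. apply scont_mult; [apply scont_const | apply scont_sqr, scont_om; auto].
  - apply scont_sumR. intros. apply scont_mult; [apply scont_const|].
    apply scont_sqr, scont_minus; [apply scont_th; auto | apply scont_const].
  - apply scont_sumR. intros. apply scont_mult; [apply scont_const|].
    apply scont_sqr, scont_minus; [apply scont_V; auto | apply scont_const].
  - apply scont_sumR. intros k Hk. destruct (Hw k Hk) as [H1 [H2 _]]. unfold edge_energy.
    apply scont_mult; [apply scont_const|].
    repeat first [ apply scont_plus | apply scont_minus | apply scont_mult | apply scont_opp
                 | apply scont_cos | apply scont_V; auto | apply scont_eta; auto
                 | apply scont_const ].
Qed.

End VectorFieldContinuity.

Definition sq_dev (N : Net) (eb Vb : nat -> R) (thb : R) (z : st) :=
  sumR (mm N) (fun k => (s_eta z k - eb k) ^ 2) +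
  sumR (nn N) (fun i => (s_om z i) ^ 2 + (s_V z i - Vb i) ^ 2 + (s_th z i - thb) ^ 2).

Lemma scont_sq_dev N eb Vb thb y : scont N (sq_dev N eb Vb thb) y.
Proof.
  unfold sq_dev. apply scont_plus.
  - apply scont_sumR. intros. apply scont_sqr, scont_minus; [apply scont_eta; auto | apply scont_const].
  - apply scont_sumR. intros. repeat apply scont_plus; apply scont_sqr.
    + apply scont_om; auto.
    + apply scont_minus; [apply scont_V; auto | apply scont_const].
    + apply scont_minus; [apply scont_th; auto | apply scont_const].
Qed.

Lemma sq_dev_ge0 N eb Vb thb z : 0 <= sq_dev N eb Vb thb z.
Proof.
  unfold sq_dev. apply Rplus_le_le_0_compat.
  - apply sumR_ge0. intros; apply pow2_ge_0.
  - apply sumR_ge0. intros. pose proof (pow2_ge_0 (s_om z i)).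
    pose proof (pow2_ge_0 (s_V z i - Vb i)). pose proof (pow2_ge_0 (s_th z i - thb)). lra.
Qed.

Lemma sq_dev_small_bounded N eb Vb thb rho : 0 <= rho ->
  exists C, forall z, sq_dev N eb Vb thb z <= rho ^ 2 -> state_bounded N C z.
Proof.
  intro Hr. destruct (finite_upper_bound (mm N) (fun k => Rabs (eb k))) as [Ce [HCe0 HCe]].
  destruct (finite_upper_bound (nn N) (fun i => Rabs (Vb i))) as [Cv [HCv0 HCv]].
  exists (Ce + Cv + Rabs thb + rho). intros z Hz. pose proof (Rabs_pos thb).
  assert (T : forall a b, Rabs a <= Rabs b + Rabs (a - b)).
  { intros. replace a with (b + (a - b)) at 1 by ring. apply Rabs_triang. }
  unfold sq_dev in Hz.
  assert (Hnode : forall i, 0 <= (s_om z i) ^ 2 + (s_V z i - Vb i) ^ 2 + (s_th z i - thb) ^ 2).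
  { intros. pose proof (pow2_ge_0 (s_om z i)). pose proof (pow2_ge_0 (s_V z i - Vb i)).
    pose proof (pow2_ge_0 (s_th z i - thb)). lra. }
  assert (H1 : 0 <= sumR (mm N) (fun k => (s_eta z k - eb k) ^ 2))
    by (apply sumR_ge0; intros; apply pow2_ge_0).
  assert (H2 : 0 <= sumR (nn N) (fun i => (s_om z i) ^ 2 + (s_V z i - Vb i) ^ 2 + (s_th z i - thb) ^ 2))
    by (apply sumR_ge0; auto).
  split.
  - intros k Hk.
    pose proof (sumR_ge_term _ (fun k => (s_eta z k - eb k) ^ 2) k (fun _ _ => pow2_ge_0 _) Hk).
    assert (Rabs (s_eta z k - eb k) <= rho) by (apply Rabs_le_of_sq; lra).
    specialize (HCe k Hk). pose proof (T (s_eta z k) (eb k)). lra.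
  - intros i Hi.
    pose proof (sumR_ge_term _ _ i (fun j _ => Hnode j) Hi).
    pose proof (pow2_ge_0 (s_om z i)). pose proof (pow2_ge_0 (s_V z i - Vb i)).
    pose proof (pow2_ge_0 (s_th z i - thb)).
    assert (Rabs (s_om z i) <= rho) by (apply Rabs_le_of_sq; lra).
    assert (Rabs (s_V z i - Vb i) <= rho) by (apply Rabs_le_of_sq; lra).
    assert (Rabs (s_th z i - thb) <= rho) by (apply Rabs_le_of_sq; lra).
    specialize (HCv i Hi). pose proof (T (s_V z i) (Vb i)). pose proof (T (s_th z i) thb). lra.
Qed.

Lemma continuity_pt_sumR n (F : nat -> R -> R) t :
  (forall i, (i < n)%nat -> continuity_pt (F i) t) ->
  continuity_pt (fun s => sumR n (fun i => F i s)) t.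
Proof.
  induction n as [|n IH]; intro H; [apply continuity_pt_const; intros a b; auto|].
  assert (E : (fun s => sumR (S n) (fun i => F i s)) = (fun s => sumR n (fun i => F i s) + F n s))
    by (apply functional_extensionality; intro; apply sumR_S).
  rewrite E. apply (continuity_pt_plus (fun s => sumR n (fun i => F i s)) (F n)).
  - apply IH; intros; apply H; lia.
  - apply H; lia.
Qed.

Lemma continuity_pt_dist (f : R -> R) t :
  continuity_pt f t -> continuity_pt (fun s => Rabs (f s - f t)) t.
Proof.
  intro H. apply (continuity_pt_comp (fun s => f s - f t) Rabs); [|apply Rcontinuity_abs].
  apply (continuity_pt_minus f (fun _ => f t)); auto.
  apply continuity_pt_const. intros a b; auto.
Qed.

Lemma solves_at_sdist_cont N q Pl c x t : solves_at N q Pl c x t ->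
  forall e, 0 < e -> exists d, 0 < d /\ forall s, Rabs (s - t) < d -> sdist N (x s) (x t) < e.
Proof.
  intros [He Hn] e Hpos.
  assert (Cdiff : forall g g', derivable_pt_lim g t g' -> continuity_pt (fun s => Rabs (g s - g t)) t)
    by (intros g g' Hg; apply continuity_pt_dist, derivable_continuous_pt; exists g'; auto).
  assert (C : continuity_pt (fun s => sdist N (x s) (x t)) t).
  { unfold sdist. apply continuity_pt_plus.
    - apply (continuity_pt_sumR (mm N) (fun k s => Rabs (s_eta (x s) k - s_eta (x t) k))).
      intros k Hk. eapply Cdiff, He, Hk.
    - apply (continuity_pt_sumR (nn N) (fun i s => Rabs (s_om (x s) i - s_om (x t) i)
             + Rabs (s_V (x s) i - s_V (x t) i) + Rabs (s_th (x s) i - s_th (x t) i))).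
      intros i Hi. destruct (Hn i Hi) as [A [B D]].
      apply continuity_pt_plus; [apply continuity_pt_plus|]; eapply Cdiff; eauto. }
  destruct (C e Hpos) as [d [Hd Hc]]. exists d. split; auto. intros s Hs.
  destruct (Req_dec s t) as [->|Hst]; [rewrite sdist_refl; lra|].
  specialize (Hc s). simpl in Hc. unfold R_dist in Hc. rewrite sdist_refl, Rminus_0_r in Hc.
  rewrite <- (Rabs_right (sdist N (x s) (x t))) by (apply Rle_ge, sdist_ge0).
  apply Hc. split; [split; [constructor | auto] | auto].
Qed.

Lemma scont_along_solution N q Pl c x t F :
  solves_at N q Pl c x t -> scont N F (x t) -> continuity_pt (fun s => F (x s)) t.
Proof.
  intros Hs HF e He. destruct (HF e He) as [d [Hd H]].
  destruct (solves_at_sdist_cont N q Pl c x t Hs d Hd) as [d2 [Hd2 H2]].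
  exists d2. split; auto. intros s [_ Hs2]. simpl in *. unfold R_dist in *. auto.
Qed.

Lemma scont_bounded_on N C (P : st -> Prop) (F : st -> R) :
  (forall z, P z -> state_bounded N C z) -> (forall y, scont N F y) ->
  exists K, forall z, P z -> Rabs (F z) <= K.
Proof.
  intros HP HF. apply NNPP. intro Hn.
  assert (Hz : forall n : nat, exists z, P z /\ INR n < Rabs (F z)).
  { intro n. apply NNPP. intro Hm. apply Hn. exists (INR n). intros z Hz.
    apply Rnot_lt_le. intro. apply Hm. exists z. auto. }
  set (zs := fun n => proj1_sig (constructive_indefinite_description _ (Hz n))).
  assert (Hzs : forall n, P (zs n) /\ INR n < Rabs (F (zs n)))
    by (intro n; apply (proj2_sig (constructive_indefinite_description _ (Hz n)))).
  clearbody zs.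
  destruct (bounded_states_cluster N C zs) as [y Hy]; [intro p; apply HP, Hzs|].
  destruct (HF y 1 ltac:(lra)) as [d [Hd H]].
  destruct (nat_above (Rabs (F y) + 1)) as [M HM].
  destruct (Hy d Hd M) as [p [Hp1 Hp2]].
  specialize (H (zs p) Hp2). destruct (Hzs p) as [_ Hp]. apply le_INR in Hp1.
  assert (Rabs (F (zs p)) <= Rabs (F y) + Rabs (F (zs p) - F y)).
  { replace (F (zs p)) with (F y + (F (zs p) - F y)) at 1 by ring. apply Rabs_triang. }
  lra.
Qed.

Lemma mvt_lipschitz (f f' : R -> R) a b K : a <= b ->
  (forall s, a <= s <= b -> derivable_pt_lim f s (f' s) /\ Rabs (f' s) <= K) ->
  Rabs (f b - f a) <= K * (b - a).
Proof.
  intros Hab H. destruct (Req_dec a b) as [->|]; [rewrite Rminus_diag, Rabs_R0; lra|].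
  destruct (MVT_cor2 f f' a b) as [c0 [E Hc]]; [lra | intros; apply H; auto|].
  rewrite E, Rabs_mult, (Rabs_right (b - a)) by lra.
  apply Rmult_le_compat_r; [lra | apply H; lra].
Qed.

Lemma solution_lipschitz N q Pl c x a b K : a <= b ->
  (forall s, a <= s <= b ->
     solves_at N q Pl c x s /\ sdist N (rhs N q Pl c (x s)) zero_state <= K) ->
  sdist N (x b) (x a) <= (INR (mm N) + 3 * INR (nn N)) * (K * (b - a)).
Proof.
  intros Hab H.
  assert (Comp : forall (g : st -> R),
    (forall s, a <= s <= b -> derivable_pt_lim (fun s => g (x s)) s (g (rhs N q Pl c (x s)))) ->
    (forall z, Rabs (g z - 0) <= sdist N z zero_state) ->
    Rabs (g (x b) - g (x a)) <= K * (b - a)).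
  { intros g Hd Hg. apply (mvt_lipschitz (fun s => g (x s)) (fun s => g (rhs N q Pl c (x s))));
      auto.
    intros s Hs. split; auto. eapply Rle_trans; [|apply (H s Hs)].
    rewrite <- (Rminus_0_r (g _)). apply Hg. }
  unfold sdist at 1.
  assert (sumR (mm N) (fun k => Rabs (s_eta (x b) k - s_eta (x a) k)) <= INR (mm N) * (K * (b - a))).
  { apply sumR_le_const. intros k Hk. apply (Comp (fun z => s_eta z k)).
    - intros s Hs. apply (proj1 (proj1 (H s Hs))), Hk.
    - intro z. apply (sdist_eta N z zero_state k Hk). }
  assert (sumR (nn N) (fun i => Rabs (s_om (x b) i - s_om (x a) i)
            + Rabs (s_V (x b) i - s_V (x a) i) + Rabs (s_th (x b) i - s_th (x a) i))
          <= INR (nn N) * (3 * (K * (b - a)))).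
  { apply sumR_le_const. intros i Hi.
    assert (Rabs (s_om (x b) i - s_om (x a) i) <= K * (b - a)).
    { apply (Comp (fun z => s_om z i)); [|intro z; apply (sdist_om N z zero_state i Hi)].
      intros s Hs. apply (proj2 (proj1 (H s Hs)) i Hi). }
    assert (Rabs (s_V (x b) i - s_V (x a) i) <= K * (b - a)).
    { apply (Comp (fun z => s_V z i)); [|intro z; apply (sdist_V N z zero_state i Hi)].
      intros s Hs. apply (proj2 (proj1 (H s Hs)) i Hi). }
    assert (Rabs (s_th (x b) i - s_th (x a) i) <= K * (b - a)).
    { apply (Comp (fun z => s_th z i)); [|intro z; apply (sdist_th N z zero_state i Hi)].
      intros s Hs. apply (proj2 (proj1 (H s Hs)) i Hi). }
    lra. }
  lra.
Qed.

Lemma sumR_DGs N V eta : wf_edges N -> sumR (nn N) (fun i => DGs N V eta i) = 0.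
Proof.
  intro Hw. unfold DGs. rewrite sumR_swap. apply sumR_eq0. intros k Hk.
  destruct (Hw k Hk) as [H1 [H2 H3]].
  transitivity (sumR (nn N) (fun i => (if i =? src N k then gam N V k * sin (eta k) else 0)
                                    + (if i =? dst N k then - (gam N V k * sin (eta k)) else 0))).
  - apply sumR_ext. intros i Hi. unfold Dinc.
    destruct (Nat.eqb_spec i (src N k)); destruct (Nat.eqb_spec i (dst N k)); try lia; ring.
  - rewrite sumR_plus, !sumR_delta by auto. ring.
Qed.

Lemma connected_const n adj (th : nat -> R) : connected n adj ->
  (forall i j, (i < n)%nat -> (j < n)%nat -> adj i j = true -> th j = th i) ->
  forall i j, (i < n)%nat -> (j < n)%nat -> th i = th j.
Proof.
  intros Hc H i j Hi Hj. pose proof (Hc i j Hi Hj) as Hr. clear Hi Hj.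
  induction Hr as [a b [Ha [Hb Hab]] | a | a b d _ IH1 _ IH2].
  - symmetry. apply H; auto.
  - auto.
  - rewrite IH1. apply IH2.
Qed.

Lemma dissipation_ge0 N c z : (forall i, (i < nn N)%nat -> 0 < Ad N i /\ 0 < Td N i) ->
  0 <= dissipation N c z.
Proof.
  intro HAT. unfold dissipation. repeat apply Rplus_le_le_0_compat.
  - apply sumR_ge0. intros i Hi. apply Rmult_le_pos; [apply Rlt_le, HAT, Hi | apply pow2_ge_0].
  - apply sumR_ge0. intros i Hi. apply Rmult_le_pos; [|apply pow2_ge_0].
    apply Rlt_le, Rinv_0_lt_compat, HAT, Hi.
  - apply Rmult_le_pos; [lra|]. apply sumR_ge0. intros. apply sumR_ge0. intros.
    destruct (c i i0); [apply pow2_ge_0 | lra].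
Qed.

Lemma dissipation_eq0 N c y : (forall i, (i < nn N)%nat -> 0 < Ad N i /\ 0 < Td N i) ->
  dissipation N c y = 0 -> forall i, (i < nn N)%nat ->
  s_om y i = 0 /\ EV N (s_eta y) (s_V y) i - Efd N i = 0 /\
  forall j, (j < nn N)%nat -> c i j = true -> s_th y j = s_th y i.
Proof.
  intros HAT H i Hi. unfold dissipation in H.
  assert (A1 : forall j, (j < nn N)%nat -> 0 <= Ad N j * (s_om y j) ^ 2)
    by (intros j Hj; apply Rmult_le_pos; [apply Rlt_le, HAT, Hj | apply pow2_ge_0]).
  assert (A2 : forall j, (j < nn N)%nat -> 0 <= / Td N j * (EV N (s_eta y) (s_V y) j - Efd N j) ^ 2)
    by (intros j Hj; apply Rmult_le_pos; [apply Rlt_le, Rinv_0_lt_compat, HAT, Hj | apply pow2_ge_0]).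
  assert (A3 : forall i j, (j < nn N)%nat ->
                 0 <= (if c i j then (s_th y j - s_th y i) ^ 2 else 0))
    by (intros i' j' _; destruct (c i' j'); [apply pow2_ge_0 | lra]).
  assert (A4 : forall i, (i < nn N)%nat ->
                 0 <= sumR (nn N) (fun j => if c i j then (s_th y j - s_th y i) ^ 2 else 0))
    by (intros; apply sumR_ge0; auto).
  pose proof (sumR_ge0 _ _ A1). pose proof (sumR_ge0 _ _ A2). pose proof (sumR_ge0 _ _ A4).
  destruct (HAT i Hi) as [Ha Ht].
  split; [|split].
  - assert (Ad N i * (s_om y i) ^ 2 = 0) by (apply (sumR_eq0_term _ _ i A1); auto; lra).
    assert ((s_om y i) ^ 2 = 0) by (apply (Rmult_eq_reg_l (Ad N i)); lra). nra.
  - assert (/ Td N i * (EV N (s_eta y) (s_V y) i - Efd N i) ^ 2 = 0)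
      by (apply (sumR_eq0_term _ _ i A2); auto; lra).
    assert (0 < / Td N i) by (apply Rinv_0_lt_compat; lra).
    assert ((EV N (s_eta y) (s_V y) i - Efd N i) ^ 2 = 0)
      by (apply (Rmult_eq_reg_l (/ Td N i)); lra). nra.
  - intros j Hj Hcij.
    assert (Z : sumR (nn N) (fun j => if c i j then (s_th y j - s_th y i) ^ 2 else 0) = 0)
      by (apply (sumR_eq0_term _ _ i A4); auto; lra).
    pose proof (sumR_eq0_term _ _ j (A3 i) Z Hj) as Zj. cbv beta in Zj. rewrite Hcij in Zj. nra.
Qed.

Lemma equilibrium_invariant N q Pl c y :
  (forall k, (k < mm N)%nat -> s_eta (rhs N q Pl c y) k = 0) ->
  (forall i, (i < nn N)%nat -> s_om (rhs N q Pl c y) i = 0 /\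
     s_V (rhs N q Pl c y) i = 0 /\ s_th (rhs N q Pl c y) i = 0) ->
  invariant N q Pl c (fun z => z = y).
Proof.
  intros Heta Hnode x0 ->. exists (fun _ => y). split; [|split; auto].
  intro t. split.
  - intros k Hk. eapply dlim_eq; [apply dlim_const | exact (eq_sym (Heta k Hk))].
  - intros i Hi. destruct (Hnode i Hi) as [A [B C]].
    split; [|split]; eapply dlim_eq; try apply dlim_const; symmetry; auto.
Qed.

Lemma const_of_zero_deriv (f : R -> R) : (forall t, derivable_pt_lim f t 0) -> forall t, f t = f 0.
Proof.
  intros H t. destruct (Rtotal_order t 0) as [Hl|[->|Hg]]; auto.
  - destruct (MVT_cor2 f (fun _ => 0) t 0) as [c0 [E _]]; auto. lra.
  - destruct (MVT_cor2 f (fun _ => 0) 0 t) as [c0 [E _]]; auto. lra.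
Qed.

Lemma deriv_of_zero_fun (f : R -> R) t l : (forall s, f s = 0) -> derivable_pt_lim f t l -> l = 0.
Proof.
  intros Hf Hd. assert (f = fun _ => 0) by (apply functional_extensionality; auto). subst.
  apply (uniqueness_limite (fun _ => 0) t); auto. apply derivable_pt_lim_const.
Qed.

Lemma choose_late_seq t0 (Q : R -> Prop) : (forall T, exists t, T <= t /\ Q t) ->
  exists ts : nat -> R, forall n, t0 + INR n <= ts n /\ Q (ts n).
Proof.
  intro H. exists (fun n => proj1_sig (constructive_indefinite_description _ (H (t0 + INR n)))).
  intro n. apply (proj2_sig (constructive_indefinite_description _ (H (t0 + INR n)))).
Qed.

Section LocalConvergence.
Variables (N : Net) (q Pl : nat -> R) (c : nat -> nat -> bool) (etab Vb : nat -> R).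
Hypothesis Hw : wf_edges N.
Hypothesis Hs : sym_edges N.
Hypothesis HB : forall k, (k < mm N)%nat -> 0 < edge_B N k.
Hypothesis HMAT : forall i, (i < nn N)%nat -> 0 < Md N i /\ 0 < Ad N i /\ 0 < Td N i.
Hypothesis Hq : forall i, (i < nn N)%nat -> 0 < q i.
Hypothesis Hc : forall i j, c i j = c j i.
Hypothesis Hcc : connected (nn N) c.
Hypothesis Heb : forall k, (k < mm N)%nat -> - (PI / 2) < etab k < PI / 2.
Hypothesis HV : forall i, (i < nn N)%nat -> 0 < Vb i.
Hypothesis Hu : forall i, (i < nn N)%nat -> ubar (nn N) q Pl i - Pl i = DGs N Vb etab i.
Hypothesis HE : forall i, (i < nn N)%nat -> EV N etab Vb i = Efd N i.
Hypothesis HP : cond_star N etab Vb.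

(* [thetabar] does not depend on the node. *)
Let thb := thetabar (nn N) q Pl 0%nat.
Let lyap := energy N etab Vb thb.
Let diss := dissipation N c.
Let dev := sq_dev N etab Vb thb.
Let xbar := mkst etab (fun _ => 0) Vb (thetabar (nn N) q Pl).

Lemma damping_pos : forall i, (i < nn N)%nat -> 0 < Ad N i /\ 0 < Td N i.
Proof. intros i Hi. destruct (HMAT i Hi) as [_ [Ha Ht]]. auto. Qed.

Lemma lyap_deriv x t : solves_at N q Pl c x t ->
  derivable_pt_lim (fun s => lyap (x s)) t (- diss (x t)).
Proof.
  intros [He Hn]. eapply dlim_eq; [apply energy_deriv; auto|].
  apply energy_rate_rhs; auto; intros i Hi.
  - destruct (HMAT i Hi) as [H _]. lra.
  - destruct (HMAT i Hi) as [_ [_ H]]. lra.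
  - specialize (Hq i Hi). lra.
Qed.

Lemma lyap_nonincr x a b : (forall s, a <= s <= b -> solves_at N q Pl c x s) -> a <= b ->
  lyap (x b) <= lyap (x a).
Proof.
  intros H Hab. destruct (Req_dec a b) as [->|]; [lra|].
  destruct (MVT_cor2 (fun s => lyap (x s)) (fun s => - diss (x s)) a b) as [c0 [E Hc0]];
    [lra | intros; apply lyap_deriv, H; auto|].
  pose proof (dissipation_ge0 N c (x c0) damping_pos).
  assert (0 <= diss (x c0) * (b - a)) by (apply Rmult_le_pos; unfold diss; lra). lra.
Qed.

Lemma lyap_xbar : lyap xbar = 0.
Proof.
  unfold lyap, energy, pot_energy, xbar. simpl.
  rewrite !sumR_eq0; [ring | | | |]; intros; unfold edge_energy, thb, thetabar; ring.
Qed.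

Lemma dev_xbar : dev xbar = 0.
Proof.
  unfold dev, sq_dev, xbar. simpl.
  rewrite !sumR_eq0; [ring | |]; intros; unfold thb, thetabar; ring.
Qed.

Lemma lyap_local_lb : exists rho mu, 0 < rho <= 1 /\ 0 < mu /\
  forall z, dev z <= rho ^ 2 -> lyap z >= mu * dev z.
Proof.
  destruct (pot_energy_lb N etab Vb Hw Hs HV Heb HB HP) as [rho [mu [Hr [Hmu H]]]].
  destruct (finite_pos_lower_bound (nn N) (Md N)) as [M0 [HM0 HM0i]]; [intros i Hi; apply HMAT; auto|].
  set (mu' := Rmin mu (Rmin (M0 / 2) (/2))).
  assert (Hm1 : mu' <= mu) by apply Rmin_l.
  assert (Hm2 : mu' <= M0 / 2) by (eapply Rle_trans; [apply Rmin_r | apply Rmin_l]).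
  assert (Hm3 : mu' <= /2) by (eapply Rle_trans; [apply Rmin_r | apply Rmin_r]).
  assert (Hm0 : 0 < mu') by (apply Rmin_glb_lt; auto; apply Rmin_glb_lt; lra).
  exists rho, mu'. split; auto. split; auto. intros z Hz. unfold dev, sq_dev in Hz.
  set (Sd := sumR (mm N) (fun k => (s_eta z k - etab k) ^ 2)) in *.
  set (Sw := sumR (nn N) (fun i => (s_om z i) ^ 2)).
  set (Sv := sumR (nn N) (fun i => (s_V z i - Vb i) ^ 2)).
  set (St := sumR (nn N) (fun i => (s_th z i - thb) ^ 2)).
  assert (Esum : sumR (nn N) (fun i => (s_om z i) ^ 2 + (s_V z i - Vb i) ^ 2 + (s_th z i - thb) ^ 2)
                 = Sw + Sv + St) by (unfold Sw, Sv, St; rewrite !sumR_plus; auto).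
  rewrite Esum in Hz.
  assert (HSd : 0 <= Sd) by (apply sumR_ge0; intros; apply pow2_ge_0).
  assert (HSw : 0 <= Sw) by (apply sumR_ge0; intros; apply pow2_ge_0).
  assert (HSv : 0 <= Sv) by (apply sumR_ge0; intros; apply pow2_ge_0).
  assert (HSt : 0 <= St) by (apply sumR_ge0; intros; apply pow2_ge_0).
  assert (HU : pot_energy N etab Vb (s_eta z) (s_V z) >= mu * (Sd + Sv)).
  { apply H; [intros k Hk | intros i Hi]; apply Rabs_le_of_sq; try lra.
    - pose proof (sumR_ge_term _ (fun k => (s_eta z k - etab k) ^ 2) k
                    (fun _ _ => pow2_ge_0 _) Hk). fold Sd in H0. lra.
    - pose proof (sumR_ge_term _ (fun i => (s_V z i - Vb i) ^ 2) i
                    (fun _ _ => pow2_ge_0 _) Hi). fold Sv in H0. lra. }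
  assert (HWw : sumR (nn N) (fun i => / 2 * Md N i * s_om z i ^ 2) >= M0 / 2 * Sw).
  { unfold Sw. rewrite <- sumR_scal. apply Rle_ge, sumR_le. intros i Hi.
    specialize (HM0i i Hi). assert (0 <= s_om z i ^ 2) by apply pow2_ge_0. nra. }
  assert (HWt : sumR (nn N) (fun i => / 2 * (s_th z i - thb) ^ 2) = /2 * St)
    by (unfold St; rewrite <- sumR_scal; auto).
  unfold lyap, energy. rewrite HWt. unfold dev, sq_dev. fold Sd. rewrite Esum.
  assert (mu' * Sd <= mu * Sd) by (apply Rmult_le_compat_r; auto).
  assert (mu' * Sv <= mu * Sv) by (apply Rmult_le_compat_r; auto).
  assert (mu' * Sw <= M0 / 2 * Sw) by (apply Rmult_le_compat_r; auto).
  assert (mu' * St <= /2 * St) by (apply Rmult_le_compat_r; auto).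
  lra.
Qed.

(* The energy dominates [dev] near [xbar] and does not increase, so a solution
   that starts with energy below [mu * rho ^ 2] never reaches the sphere [dev = rho ^ 2]. *)
Lemma dev_stays_small rho mu x t0 :
  (forall z, dev z <= rho ^ 2 -> lyap z >= mu * dev z) ->
  (forall t, 0 < t -> solves_at N q Pl c x t) -> 0 < t0 ->
  dev (x t0) < rho ^ 2 -> lyap (x t0) < mu * rho ^ 2 ->
  forall t, t0 <= t -> dev (x t) < rho ^ 2.
Proof.
  intros HL Hsol Ht0 Hdev0 Hlyap0 t Ht. apply Rnot_le_lt. intro Hge.
  assert (Hcross : exists s, t0 <= s <= t /\ dev (x s) = rho ^ 2).
  { destruct (Req_dec (dev (x t)) (rho ^ 2)) as [E|E]; [exists t; split; [lra | auto]|].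
    destruct (IVT_interv (fun s => dev (x s) - rho ^ 2) t0 t) as [s [Hs1 Es]];
      [| destruct (Req_dec t0 t) as [<-|]; lra | lra | lra |].
    - intros a Ha. apply (continuity_pt_minus (fun s => dev (x s)) (fun _ => rho ^ 2)).
      + apply (scont_along_solution N q Pl c x a dev); [apply Hsol; lra | apply scont_sq_dev].
      + apply continuity_pt_const. intros u v; auto.
    - exists s. split; auto. lra. }
  destruct Hcross as [s [Hs1 Es]].
  assert (lyap (x s) <= lyap (x t0)) by (apply lyap_nonincr; [intros; apply Hsol | ]; lra).
  specialize (HL (x s) ltac:(lra)). rewrite Es in HL. lra.
Qed.

Lemma eventually_confined : exists rho delta, 0 < rho /\ 0 < delta /\
  forall x, fwd_sol N q Pl c x -> sdist N (x 0) xbar < delta ->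
  exists t0, 0 < t0 /\ forall t, t0 <= t -> dev (x t) < rho ^ 2 /\ 0 <= lyap (x t).
Proof.
  destruct lyap_local_lb as [rho [mu [Hr [Hmu HL]]]].
  assert (Hm : 0 < mu * rho ^ 2) by (apply Rmult_lt_0_compat; auto; nra).
  destruct (scont_energy N Hw etab Vb thb xbar (mu * rho ^ 2) Hm) as [d1 [Hd1 H1]].
  destruct (scont_sq_dev N etab Vb thb xbar (rho ^ 2) ltac:(nra)) as [d2 [Hd2 H2]].
  set (d := Rmin d1 d2). assert (Hd : 0 < d) by (apply Rmin_glb_lt; auto).
  exists rho, (d / 2). split; [lra|]. split; [lra|].
  intros x [Hsol Hc0] Hx0.
  destruct (Hc0 (d / 2)) as [del [Hdel Hdx]]; [lra|].
  set (t0 := del / 2). exists t0. split; [unfold t0; lra|].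
  assert (Hxt0 : sdist N (x t0) xbar < d).
  { pose proof (sdist_triang N (x t0) (x 0) xbar).
    assert (sdist N (x t0) (x 0) < d / 2) by (apply Hdx; unfold t0; lra). lra. }
  assert (Hlyap0 : lyap (x t0) < mu * rho ^ 2).
  { specialize (H1 (x t0) ltac:(eapply Rlt_le_trans; [apply Hxt0 | apply Rmin_l])).
    fold lyap in H1. rewrite lyap_xbar, Rminus_0_r in H1. pose proof (Rle_abs (lyap (x t0))). lra. }
  assert (Hdev0 : dev (x t0) < rho ^ 2).
  { specialize (H2 (x t0) ltac:(eapply Rlt_le_trans; [apply Hxt0 | apply Rmin_r])).
    fold dev in H2. rewrite dev_xbar, Rminus_0_r in H2. pose proof (Rle_abs (dev (x t0))). lra. }
  intros t Ht. assert (Hsmall : dev (x t) < rho ^ 2).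
  { apply (dev_stays_small rho mu x t0); auto. unfold t0; lra. }
  split; auto. specialize (HL (x t) ltac:(lra)).
  pose proof (sq_dev_ge0 N etab Vb thb (x t)). fold dev in H.
  assert (0 <= mu * dev (x t)) by (apply Rmult_le_pos; lra). lra.
Qed.

Section Trajectory.
Variables (x : R -> st) (t0 rho : R).
Hypothesis Hsol : forall t, 0 < t -> solves_at N q Pl c x t.
Hypothesis Ht0 : 0 < t0.
Hypothesis Hrho : 0 < rho.
Hypothesis Hconf : forall t, t0 <= t -> dev (x t) < rho ^ 2 /\ 0 <= lyap (x t).

Definition late_cluster (ts : nat -> R) (y : st) :=
  (forall n, t0 + INR n <= ts n) /\
  forall e, 0 < e -> forall M, exists p, (M <= p)%nat /\ sdist N (x (ts p)) y < e.

Lemma traj_bounded : exists C, forall t, t0 <= t -> state_bounded N C (x t).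
Proof.
  destruct (sq_dev_small_bounded N etab Vb thb rho) as [C HC]; [lra|].
  exists C. intros t Ht. apply HC. left; apply Hconf; auto.
Qed.

Lemma late_cluster_exists ts : (forall n, t0 + INR n <= ts n) -> exists y, late_cluster ts y.
Proof.
  intro Hts. destruct traj_bounded as [C HC].
  destruct (bounded_states_cluster N C (fun n => x (ts n))) as [y Hy].
  - intro n. apply HC. specialize (Hts n). pose proof (pos_INR n). lra.
  - exists y. split; auto.
Qed.

Lemma traj_lipschitz : exists L, 0 <= L /\
  forall a b, t0 <= a <= b -> sdist N (x b) (x a) <= L * (b - a).
Proof.
  destruct (sq_dev_small_bounded N etab Vb thb rho) as [C HC]; [lra|].
  destruct (scont_bounded_on N C (fun z => dev z <= rho ^ 2)
              (fun z => sdist N (rhs N q Pl c z) zero_state)) as [K HK];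
    [auto | intro y; apply scont_speed; auto|].
  exists ((INR (mm N) + 3 * INR (nn N)) * Rmax K 0). split.
  { apply Rmult_le_pos; [|apply Rmax_r]. pose proof (pos_INR (mm N)). pose proof (pos_INR (nn N)). lra. }
  intros a b Hab. rewrite Rmult_assoc. apply (solution_lipschitz N q Pl c); [lra|].
  intros s Hs1. split; [apply Hsol; lra|].
  eapply Rle_trans; [apply Rle_abs|]. eapply Rle_trans; [|apply Rmax_l].
  apply HK. left; apply Hconf; lra.
Qed.

Lemma lyap_cauchy beta : 0 < beta ->
  exists T, t0 <= T /\ forall a b, T <= a <= b -> lyap (x a) - lyap (x b) < beta.
Proof.
  intro Hb. set (E := fun v => exists t, t0 <= t /\ v = - lyap (x t)).
  destruct (completeness E) as [m0 [Hub Hlub]].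
  - exists 0. intros v [t [Ht ->]]. pose proof (proj2 (Hconf t Ht)). lra.
  - exists (- lyap (x t0)). exists t0. split; auto; lra.
  - assert (exists t1, t0 <= t1 /\ m0 - beta < - lyap (x t1)) as [t1 [Ht1 Hm]].
    { apply NNPP. intro Hn. assert (is_upper_bound E (m0 - beta)); [|specialize (Hlub _ H); lra].
      intros v [t [Ht ->]]. apply Rnot_lt_le. intro. apply Hn. exists t. auto. }
    exists t1. split; auto. intros a b Hab.
    assert (lyap (x a) <= lyap (x t1)) by (apply lyap_nonincr; [intros; apply Hsol | ]; lra).
    assert (- lyap (x b) <= m0) by (apply Hub; exists b; split; auto; lra). lra.
Qed.

(* Lipschitz continuity of the trajectory turns closeness to a cluster value at
   one late time into closeness on a whole window of fixed length. *)
Lemma cluster_window F ts y : late_cluster ts y -> scont N F y ->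
  forall e, 0 < e -> exists tau, 0 < tau /\ forall T, exists a, T <= a /\ t0 <= a /\
    forall s, a <= s <= a + tau -> Rabs (F (x s) - F y) < e.
Proof.
  intros [Hts Hcl] HF e He. destruct (HF e He) as [r [Hr H1]].
  destruct traj_lipschitz as [L [HL0 HL]].
  set (tau := r / (2 * (L + 1))).
  assert (Htau : 0 < tau) by (unfold tau; apply Rdiv_lt_0_compat; lra).
  assert (HLt : L * tau < r / 2).
  { unfold tau. replace (L * (r / (2 * (L + 1)))) with ((r / 2) * (L / (L + 1))) by (field; lra).
    assert (L / (L + 1) < 1).
    { apply (Rmult_lt_reg_r (L + 1)); [lra|]. unfold Rdiv.
      rewrite Rmult_assoc, Rinv_l by lra. lra. }
    nra. }
  exists tau. split; auto. intro T. destruct (nat_above T) as [M HM].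
  destruct (Hcl (r / 2) ltac:(lra) M) as [p [Hp Hpy]].
  specialize (Hts p). apply le_INR in Hp. pose proof (pos_INR p).
  exists (ts p). split; [lra|]. split; [lra|]. intros s Hs1. apply H1.
  assert (sdist N (x s) (x (ts p)) <= L * (s - ts p)) by (apply HL; lra).
  assert (L * (s - ts p) <= L * tau) by (apply Rmult_le_compat_l; lra).
  pose proof (sdist_triang N (x s) (x (ts p)) y). lra.
Qed.

Lemma cluster_diss0 ts y : late_cluster ts y -> diss y = 0.
Proof.
  intro Hcl. pose proof (dissipation_ge0 N c y damping_pos). fold diss in H.
  destruct (Req_dec (diss y) 0) as [E|E]; auto. exfalso.
  set (d := diss y). assert (Hd : 0 < d) by (unfold d; lra).
  destruct (cluster_window diss ts y Hcl (scont_dissipation N c y) (d / 2))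
    as [tau [Htau Hwin]]; [lra|].
  destruct (lyap_cauchy (d * tau / 2)) as [T [HT HTc]]; [nra|].
  destruct (Hwin T) as [a [Ha [Ha0 Hin]]].
  destruct (MVT_cor2 (fun s => lyap (x s)) (fun s => - diss (x s)) a (a + tau)) as [c0 [E1 Hc0]];
    [lra | intros; apply lyap_deriv, Hsol; lra|].
  specialize (Hin c0 ltac:(lra)). apply Rabs_def2 in Hin. fold d in Hin.
  specialize (HTc a (a + tau) ltac:(lra)).
  replace (a + tau - a) with tau in E1 by ring. nra.
Qed.

Lemma eventually_near (P : st -> Prop) : (forall ts y, late_cluster ts y -> P y) ->
  forall e, 0 < e -> exists T, forall t, T <= t -> exists y, P y /\ sdist N (x t) y < e.
Proof.
  intros HPP e He. apply NNPP. intro Hn.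
  assert (Hfar : forall T, exists t, T <= t /\ forall y, P y -> e <= sdist N (x t) y).
  { intro T. apply NNPP. intro Hm. apply Hn. exists T. intros t Ht. apply NNPP. intro Hk.
    apply Hm. exists t. split; auto. intros y Hy. apply Rnot_lt_le. intro. apply Hk. exists y. auto. }
  destruct (choose_late_seq t0 _ Hfar) as [ts Hts].
  destruct (late_cluster_exists ts) as [y Hy]; [apply Hts|].
  destruct (proj2 Hy e He 0%nat) as [p [_ Hp]].
  pose proof (proj2 (Hts p) y (HPP ts y Hy)). lra.
Qed.

Lemma converges_of_cluster_values (F : st -> R) l : (forall y, scont N F y) ->
  (forall ts y, late_cluster ts y -> F y = l) ->
  forall e, 0 < e -> exists T, forall t, T <= t -> Rabs (F (x t) - l) < e.
Proof.
  intros HF HPP e He. apply NNPP. intro Hn.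
  assert (Hfar : forall T, exists t, T <= t /\ e <= Rabs (F (x t) - l)).
  { intro T. apply NNPP. intro Hm. apply Hn. exists T. intros t Ht. apply Rnot_le_lt. intro.
    apply Hm. exists t. auto. }
  destruct (choose_late_seq t0 _ Hfar) as [ts Hts].
  destruct (late_cluster_exists ts) as [y Hy]; [apply Hts|].
  destruct (HF y e He) as [d [Hd Hd2]].
  destruct (proj2 Hy d Hd 0%nat) as [p [_ Hp]].
  specialize (Hd2 _ Hp). rewrite (HPP ts y Hy) in Hd2. pose proof (proj2 (Hts p)). lra.
Qed.

Lemma om_converges i : (i < nn N)%nat ->
  forall e, 0 < e -> exists T, forall t, T <= t -> Rabs (s_om (x t) i - 0) < e.
Proof.
  intro Hi. apply (converges_of_cluster_values (fun z => s_om z i)); [intro; apply scont_om; auto|].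
  intros ts y Hcl. apply (dissipation_eq0 N c y damping_pos (cluster_diss0 ts y Hcl) i Hi).
Qed.

(* Since omega_i tends to 0, its derivative cannot stay away from 0 on windows of
   fixed length. *)
Lemma cluster_om_rate0 ts y i : late_cluster ts y -> (i < nn N)%nat ->
  s_om (rhs N q Pl c y) i = 0.
Proof.
  intros Hcl Hi. set (g := s_om (rhs N q Pl c y) i).
  destruct (Req_dec g 0) as [E|E]; auto. exfalso.
  assert (Hg : 0 < Rabs g) by (apply Rabs_pos_lt; auto).
  destruct (cluster_window (fun z => s_om (rhs N q Pl c z) i) ts y Hcl
              (scont_rhs_om N q Pl c Hw i y Hi) (Rabs g / 2)) as [tau [Htau Hwin]]; [lra|].
  destruct (om_converges i Hi (Rabs g * tau / 4)) as [T HT]; [nra|].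
  destruct (Hwin T) as [a [Ha [Ha0 Hin]]].
  destruct (MVT_cor2 (fun s => s_om (x s) i) (fun s => s_om (rhs N q Pl c (x s)) i) a (a + tau))
    as [c0 [E1 Hc0]]; [lra | intros s Hs1; apply (proj2 (Hsol s ltac:(lra)) i Hi)|].
  specialize (Hin c0 ltac:(lra)). fold g in Hin.
  pose proof (Rabs_triang_inv g (s_om (rhs N q Pl c (x c0)) i)). rewrite Rabs_minus_sym in Hin.
  replace (a + tau - a) with tau in E1 by ring.
  pose proof (HT a ltac:(lra)). pose proof (HT (a + tau) ltac:(lra)). rewrite !Rminus_0_r in *.
  pose proof (Rabs_sub_triang (s_om (x (a + tau)) i) 0 (s_om (x a) i)) as Tri.
  rewrite Rminus_0_l, Rminus_0_r, Rabs_Ropp, E1, Rabs_mult, (Rabs_right tau) in Tri by lra.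
  nra.
Qed.

Lemma cluster_equilibrium ts y : late_cluster ts y ->
  Omega N q Pl y /\ (forall k, (k < mm N)%nat -> s_eta (rhs N q Pl c y) k = 0) /\
  (forall i, (i < nn N)%nat -> s_om (rhs N q Pl c y) i = 0 /\
     s_V (rhs N q Pl c y) i = 0 /\ s_th (rhs N q Pl c y) i = 0).
Proof.
  intro Hcl. pose proof (dissipation_eq0 N c y damping_pos (cluster_diss0 ts y Hcl)) as DZ.
  assert (Hth : forall i j, (i < nn N)%nat -> (j < nn N)%nat -> s_th y i = s_th y j)
    by (apply (connected_const (nn N) c); auto; intros i j Hi Hj Hij; apply (DZ i Hi); auto).
  assert (HG : forall i, (i < nn N)%nat -> / q i * s_th y i - DGs N (s_V y) (s_eta y) i - Pl i = 0).
  { intros i Hi. pose proof (cluster_om_rate0 ts y i Hcl Hi) as G. simpl in G. unfold uctl in G.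
    destruct (DZ i Hi) as [Ho _]. rewrite Ho in G. destruct (HMAT i Hi) as [HMi _].
    apply (Rmult_eq_reg_l (/ Md N i)); [|apply Rgt_not_eq, Rinv_0_lt_compat; lra].
    rewrite Rmult_0_r, <- G. ring. }
  (* summing the swing equations over the nodes kills the line flows *)
  assert (Hthb : forall i, (i < nn N)%nat -> s_th y i = thetabar (nn N) q Pl i).
  { intros i Hi.
    assert (S1 : sumR (nn N) (fun j => / q j * s_th y j - DGs N (s_V y) (s_eta y) j - Pl j) = 0)
      by (apply sumR_eq0; auto).
    rewrite !sumR_minus, sumR_DGs in S1 by auto.
    assert (S2 : sumR (nn N) (fun j => / q j * s_th y j) = s_th y i * sumR (nn N) (fun j => / q j)).
    { rewrite <- sumR_scal. apply sumR_ext. intros j Hj. rewrite (Hth i j); auto. ring. }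
    assert (Qp : 0 < sumR (nn N) (fun j => / q j)).
    { pose proof (sumR_ge_term _ (fun j => / q j) i
                    (fun j Hj => Rlt_le _ _ (Rinv_0_lt_compat _ (Hq j Hj))) Hi).
      pose proof (Rinv_0_lt_compat _ (Hq i Hi)). lra. }
    unfold thetabar. apply (Rmult_eq_reg_r (sumR (nn N) (fun j => / q j))); [|lra].
    unfold Rdiv. rewrite Rmult_assoc, Rinv_l by lra. lra. }
  split; [|split].
  - intros i Hi. destruct (DZ i Hi) as [A [B _]]. auto.
  - intros k Hk. simpl. apply sumR_eq0. intros i Hi. destruct (DZ i Hi) as [A _]. rewrite A. ring.
  - intros i Hi. destruct (DZ i Hi) as [A [B _]].
    split; [apply (cluster_om_rate0 ts y); auto|]. simpl. split.
    + replace (- EV N (s_eta y) (s_V y) i + Efd N i) with (- (EV N (s_eta y) (s_V y) i - Efd N i))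
        by ring. rewrite B. ring.
    + rewrite A, sumR_eq0; [ring|]. intros j Hj. destruct (c i j); auto.
      rewrite (Hth j i); auto. ring.
Qed.

End Trajectory.

Lemma local_convergence : exists delta, 0 < delta /\
  forall x, fwd_sol N q Pl c x -> sdist N (x 0) xbar < delta ->
  converges_to_set N x (largest_invariant N q Pl c (Omega N q Pl)) /\
  (forall i, (i < nn N)%nat ->
     converges_to (fun t => s_om (x t) i) 0 /\
     converges_to (fun t => uctl q (x t) i) (ubar (nn N) q Pl i)).
Proof.
  destruct eventually_confined as [rho [delta [Hrho [Hd Hconf]]]]. exists delta. split; auto.
  intros x Hx Hx0. destruct (Hconf x Hx Hx0) as [t0 [Ht0 Hcf]]. destruct Hx as [Hsol _].
  split; [|intros i Hi; split].
  - intros e He. apply (eventually_near x t0 rho); auto.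
    intros ts y Hcl.
    destruct (cluster_equilibrium x t0 rho Hsol Ht0 Hrho Hcf ts y Hcl) as [HO [Heta Hnode]].
    exists (fun z => z = y). split; [apply equilibrium_invariant; auto|].
    split; [intros z ->; auto | auto].
  - intros e He. apply (om_converges x t0 rho); auto.
  - intros e He. apply (converges_of_cluster_values x t0 rho Hrho Hcf (fun z => uctl q z i)); auto.
    + intro y. unfold uctl. apply scont_mult; [apply scont_const | apply scont_th; auto].
    + intros ts y Hcl. destruct (cluster_equilibrium x t0 rho Hsol Ht0 Hrho Hcf ts y Hcl) as [HO _].
      destruct (HO i Hi) as [_ [_ Ht]]. unfold uctl, ubar. rewrite Ht. auto.
Qed.

End LocalConvergence.

Lemma Omega_solution_equilibrium N q Pl c : (forall i, (i < nn N)%nat -> 0 < Md N i) ->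
  forall x : R -> st, full_sol N q Pl c x -> (forall t, Omega N q Pl (x t)) ->
  exists etat Vt : nat -> R,
    (forall t k, (k < mm N)%nat -> s_eta (x t) k = etat k) /\
    (forall t i, (i < nn N)%nat -> s_V (x t) i = Vt i) /\
    (forall i, (i < nn N)%nat ->
       0 = ubar (nn N) q Pl i - DGs N Vt etat i - Pl i /\ 0 = - EV N etat Vt i + Efd N i).
Proof.
  intros HM x Hx HO. exists (s_eta (x 0)), (s_V (x 0)). split; [|split].
  - intros t k Hk. apply (const_of_zero_deriv (fun s => s_eta (x s) k)). intro s.
    eapply dlim_eq; [apply (proj1 (Hx s)), Hk|]. simpl. apply sumR_eq0. intros i Hi.
    rewrite (proj1 (HO s i Hi)). ring.
  - intros t i Hi. apply (const_of_zero_deriv (fun s => s_V (x s) i)). intro s.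
    eapply dlim_eq; [apply (proj2 (Hx s) i Hi)|]. simpl.
    destruct (HO s i Hi) as [_ [B _]].
    replace (- EV N (s_eta (x s)) (s_V (x s)) i + Efd N i)
      with (- (EV N (s_eta (x s)) (s_V (x s)) i - Efd N i)) by ring.
    rewrite B. ring.
  - intros i Hi. destruct (HO 0 i Hi) as [A [B C]]. split; [|lra].
    pose proof (deriv_of_zero_fun (fun s => s_om (x s) i) 0 _ (fun s => proj1 (HO s i Hi))
                  (proj1 (proj2 (Hx 0) i Hi))) as G.
    simpl in G. unfold uctl in G. rewrite A, C in G. unfold ubar.
    apply Rmult_integral in G. destruct G as [G|G]; [|lra].
    exfalso. pose proof (Rinv_0_lt_compat _ (HM i Hi)). lra.
Qed.

Theorem theorem2 :
  forall (N : Net) (q Pl : nat -> R) (c : nat -> nat -> bool),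
    wf_net N ->
    (forall i, (i < nn N)%nat -> 0 < q i) ->
    (* communication graph: undirected, no self loops, connected *)
    (forall i j, c i j = c j i) -> (forall i, c i i = false) ->
    connected (nn N) c ->
    forall etab Vb : nat -> R,
      (* etab in R(D^T) *)
      (exists phi : nat -> R, forall k, (k < mm N)%nat ->
          etab k = sumR (nn N) (fun i => Dinc N i k * phi i)) ->
      (forall k, (k < mm N)%nat -> - (PI / 2) < etab k < PI / 2) ->
      (forall i, (i < nn N)%nat -> 0 < Vb i) ->
      (forall i, (i < nn N)%nat -> ubar (nn N) q Pl i - Pl i = DGs N Vb etab i) ->
      (forall i, (i < nn N)%nat -> EV N etab Vb i = Efd N i) ->
      cond_star N etab Vb ->
      let xbar := mkst etab (fun _ => 0) Vb (thetabar (nn N) q Pl) in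
      (exists delta, 0 < delta /\
        forall x : R -> st, fwd_sol N q Pl c x -> sdist N (x 0) xbar < delta ->
          converges_to_set N x (largest_invariant N q Pl c (Omega N q Pl)) /\
          (forall i, (i < nn N)%nat ->
             converges_to (fun t => s_om (x t) i) 0 /\
             converges_to (fun t => uctl q (x t) i) (ubar (nn N) q Pl i))) /\
      (* description of the largest invariant set: along any solution
         staying in Omega, eta and V are constant and the equilibrium
         equations hold *)
      (forall x : R -> st, full_sol N q Pl c x -> (forall t, Omega N q Pl (x t)) ->
         exists etat Vt : nat -> R,
           (forall t k, (k < mm N)%nat -> s_eta (x t) k = etat k) /\
           (forall t i, (i < nn N)%nat -> s_V (x t) i = Vt i) /\
           (forall i, (i < nn N)%nat ->
              0 = ubar (nn N) q Pl i - DGs N Vt etat i - Pl i /\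
              0 = - EV N etat Vt i + Efd N i)).
Proof.
  intros N q Pl c HN Hq Hc _ Hcc etab Vb _ Heb HV Hu HE HP xbar.
  destruct HN as [Hw [_ [_ [HBs [_ [_ HMAT]]]]]].
  split.
  - apply (local_convergence N q Pl c etab Vb); auto; intros k Hk; apply HBs; auto.
  - apply Omega_solution_equilibrium. intros i Hi. apply HMAT; auto.
Qed.
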